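(* Let $k\ge s\ge1$ be integers. Let $y(t)$ be the solution of the augmented semi-discrete problem $\dot y=\tilde J_N\nabla\tilde H(y)$, $y(0)=y_0$ (defined in the context), obtained from the semilinear wave equation with Dirichlet boundary conditions $u(0,t)=\varphi_0(t)$, $u(1,t)=\varphi_1(t)$, and let $y_1=u(h)$ be the approximation to $y(h)$ provided by the HBVM$(k,s)$ method used with stepsize $h$. Then, as $h\to0$, $$y_1-y(h)=O(h^{2s+1}),$$ that is, the method has order $2s$. Moreover, assuming that $f$, $\varphi_0$ and $\varphi_1$ are suitably regular, $$\tilde H(y_1)-\tilde H(y_0)=\begin{cases}0,&\text{if } f\in\Pi_\nu,\ \varphi_0,\varphi_1\in\Pi_\rho \text{ and } k\ge\frac12\max\{\nu s,\ 2\rho+s-1,\ \rho+2s-1\},\\ O(h^{2k+1}),&\text{otherwise.}\end{cases}$$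
   Context: $\Pi_\nu$ denotes the set of polynomials of degree at most $\nu$. ''Suitably regular'' means sufficiently many times continuously differentiable; this is a standing assumption on $f:\mathbb{R}\to\mathbb{R}$ and on $\varphi_0,\varphi_1$. Semi-discrete problem: consider $u_{tt}=u_{xx}-f'(u)$ on $(0,1)\times(0,\infty)$ with initial data $u(x,0)=\psi_0(x)$, $u_t(x,0)=\psi_1(x)$ and boundary conditions $u(0,t)=\varphi_0(t)$, $u(1,t)=\varphi_1(t)$. Let $\Delta x=1/(N+1)$, $x_i=i\Delta x$, $q=(u_1,\dots,u_N)^\top$, $p=(v_1,\dots,v_N)^\top\in\mathbb{R}^N$ (with $u_i(t)\approx u(x_i,t)$, $v_i(t)\approx u_t(x_i,t)$), let $T_N\in\mathbb{R}^{N\times N}$ be the tridiagonal matrix with $2$ on the diagonal and $-1$ on the first sub- and superdiagonals, and let $\varphi(t)=(\varphi_0(t),0,\dots,0,\varphi_1(t))^\top\in\mathbb{R}^N$. The semi-discrete (non-autonomous) Hamiltonian is $$H(q,p,t)=\Delta x\left[\frac{p^\top p}{2}+\frac{q^\top T_Nq}{2\Delta x^2}+\sum_{i=1}^Nf(u_i)\right]+\frac{\varphi(t)^\top\varphi(t)}{2\Delta x}-\frac{q^\top\varphi(t)}{\Delta x}.$$ Introducing auxiliary conjugate scalar variables $\tilde q\ (\equiv t)$ and $\tilde p$, the augmented Hamiltonian is $$\tilde H(q,p,\tilde q,\tilde p)=H(q,p,\tilde q)+\tilde p,$$ and with $y=(q,p,\tilde q,\tilde p)\in\mathbb{R}^{2N+2}$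 the augmented problem is $\dot y=\tilde J_N\nabla\tilde H(y)$, that is, $\dot q=\frac1{\Delta x}\nabla_p\tilde H$, $\dot p=-\frac1{\Delta x}\nabla_q\tilde H$, $\frac{d}{dt}\tilde q=\partial_{\tilde p}\tilde H=1$, $\frac{d}{dt}\tilde p=-\partial_{\tilde q}\tilde H$, where $\tilde J_N$ is block diagonal with blocks $\frac1{\Delta x}\begin{pmatrix}0&I_N\\-I_N&0\end{pmatrix}$ and $\begin{pmatrix}0&1\\-1&0\end{pmatrix}$. The initial value is $y_0=(\psi_0(x_1),\dots,\psi_0(x_N),\psi_1(x_1),\dots,\psi_1(x_N),0,0)^\top$. HBVM$(k,s)$ method with stepsize $h$: let $\{P_j\}_{j\ge0}$ be the orthonormal Legendre polynomials on $[0,1]$ ($\deg P_j=j$, $\int_0^1P_iP_j\,dx=\delta_{ij}$), and let $c_1,\dots,c_k$ and $b_1,\dots,b_k$ be the nodes and weights of the Gauss-Legendre quadrature formula on $[0,1]$ (of order $2k$). One looks for a polynomial $u$ of degree at most $s$ with values in $\mathbb{R}^{2N+2}$ such that $u(0)=y_0$ and $$\dot u(ch)=\sum_{j=0}^{s-1}\hat\gamma_j(u)P_j(c),\quad c\in[0,1],\qquad \hat\gamma_j(u)=\sum_{i=1}^kb_iP_j(c_i)\,\tilde J_N\nabla\tilde H(u(c_ih)),\quad j=0,\dots,s-1,$$ and sets $y_1=u(h)$.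
   Formalization: For the O() claims, the HBVM polynomials u are assumed to exist for all small h>0 and to stay bounded on [0,h] as h→0; the implicit equations can have spurious solutions blowing up as h→0 (e.g. k=s=1, f(u)=-u^4/4), for which the claims fail. *)

(* Defs.v *)
From HB Require Import structures.
From mathcomp Require Export all_boot all_order all_algebra.
From mathcomp Require Export all_classical all_reals all_analysis.
Set Implicit Arguments.
Unset Strict Implicit.
Unset Printing Implicit Defensive.
Export Order.TTheory GRing.Theory Num.Theory.
Export numFieldNormedType.Exports.
Local Open Scope classical_set_scope.
Local Open Scope ring_scope.

Definition cont_diff (R : realType) (m : nat) (f : R -> R) : Prop :=
  (forall n, (n < m)%N -> forall x : R, derivable (derive1n n f) x 1) /\
  continuous (derive1n m f).

(* f \in \Pi_nu; MathComp's [size] is the degree plus one. *)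
Definition is_poly_le (R : realType) (nu : nat) (f : R -> R) : Prop :=
  exists2 p : {poly R}, (size p <= nu.+1)%N & forall x, f x = p.[x].

Definition dx (R : realType) (N : nat) : R := N.+1%:R^-1.

(* x_{i+1}: the indices in ['I_N] start at 0. *)
Definition mesh (R : realType) (N : nat) (i : 'I_N) : R := i.+1%:R * dx R N.

Definition T_mx (R : realType) (N : nat) : 'M[R]_N :=
  \matrix_(i, j) (if i == j then 2
                  else if (i.+1 == j) || (j.+1 == i) then -1 else 0).

(* (phi0 t, 0, ..., 0, phi1 t)^T.  When N = 1 the single mesh point is adjacent
   to both boundary points and the entry is phi0 t + phi1 t. *)
Definition bdry (R : realType) (N : nat) (phi0 phi1 : R -> R) (t : R)
    : 'cV[R]_N :=
  \col_i ((if i == 0 :> nat then phi0 t else 0) +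
          (if i.+1 == N then phi1 t else 0)).

Definition Ham (R : realType) (N : nat) (f phi0 phi1 : R -> R)
    (q p : 'cV[R]_N) (t : R) : R :=
  let D := dx R N in
  let ph := bdry N phi0 phi1 t in
  D * ((p^T *m p) 0 0 / 2 + (q^T *m T_mx R N *m q) 0 0 / (2 * D ^+ 2)
       + \sum_i f (q i 0))
  + (ph^T *m ph) 0 0 / (2 * D) - (q^T *m ph) 0 0 / D.

(* Augmented states y = (q, p, q~, p~). *)
Notation state R N := 'cV[R]_(N + N + (1 + 1)).

Definition st_q (R : realType) (N : nat) (y : state R N) : 'cV[R]_N :=
  usubmx (usubmx y).
Definition st_p (R : realType) (N : nat) (y : state R N) : 'cV[R]_N :=
  dsubmx (usubmx y).
Definition st_qt (R : realType) (N : nat) (y : state R N) : R :=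
  usubmx (dsubmx y) 0 0.
Definition st_pt (R : realType) (N : nat) (y : state R N) : R :=
  dsubmx (dsubmx y) 0 0.

Definition aHam (R : realType) (N : nat) (f phi0 phi1 : R -> R)
    (y : state R N) : R :=
  Ham f phi0 phi1 (st_q y) (st_p y) (st_qt y) + st_pt y.

Definition grad (R : realType) (n : nat) (F : 'cV[R]_n -> R) (y : 'cV[R]_n)
    : 'cV[R]_n :=
  \col_i 'D_(delta_mx i 0) F y.

Definition symp (R : realType) (n : nat) : 'M[R]_(n + n) :=
  block_mx 0 1%:M (- 1%:M) 0.

Definition aJ (R : realType) (N : nat) : 'M[R]_(N + N + (1 + 1)) :=
  block_mx ((dx R N)^-1 *: symp R N) 0 0 (symp R 1).

Definition vfield (R : realType) (N : nat) (f phi0 phi1 : R -> R)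
    (y : state R N) : state R N :=
  aJ R N *m grad (aHam f phi0 phi1) y.

Definition init (R : realType) (N : nat) (psi0 psi1 : R -> R) : state R N :=
  col_mx (col_mx (\col_i psi0 (mesh R i)) (\col_i psi1 (mesh R i))) 0.

(* y solves y' = vfield y, y 0 = y0 on [0, T).  The equation is required on
   (0, T) together with right continuity at 0; the values of y outside [0, T)
   are irrelevant.  (For a continuous vector field the equation then also holds
   at 0 with the right derivative.) *)
Definition is_solution (R : realType) (N : nat) (f phi0 phi1 : R -> R)
    (y0 : state R N) (T : R) (y : R -> state R N) : Prop :=
  [/\ y 0 = y0,
      y t @[t --> 0^'+] --> y 0
    & forall t : R, 0 < t < T -> is_derive t 1 y (vfield f phi0 phi1 (y t))].

(* Orthonormal Legendre polynomials on [0, 1]; they are determined up to sign,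
   and the method below does not depend on the signs. *)
Definition legendre_family (R : realType) (P : nat -> {poly R}) : Prop :=
  (forall j, size (P j) = j.+1) /\
  (forall i j, \int[lebesgue_measure]_(x in `[0, 1]) ((P i).[x] * (P j).[x])
               = (i == j)%:R).

(* The k nodes are the roots of P_k, the weights are those of the interpolatory
   quadrature formula, i.e. the integrals of the Lagrange basis polynomials. *)
Definition gauss_legendre (R : realType) (P : nat -> {poly R}) (k : nat)
    (c b : 'I_k -> R) : Prop :=
  [/\ injective c,
      forall i, root (P k) (c i)
    & forall i, b i = \int[lebesgue_measure]_(x in `[0, 1])
                        \prod_(j < k | j != i) ((x - c j) / (c i - c j))].

Definition peval (R : realType) (n : nat) (u : 'cV[{poly R}]_n) (t : R)
    : 'cV[R]_n :=
  map_mx (fun p : {poly R} => p.[t]) u.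

Definition pderiv (R : realType) (n : nat) (u : 'cV[{poly R}]_n)
    : 'cV[{poly R}]_n :=
  map_mx (fun p : {poly R} => deriv p) u.

Definition hbvm_gamma (R : realType) (P : nat -> {poly R}) (k : nat)
    (c b : 'I_k -> R) (n : nat) (F : 'cV[R]_n -> 'cV[R]_n) (h : R)
    (u : 'cV[{poly R}]_n) (j : nat) : 'cV[R]_n :=
  \sum_(i < k) (b i * (P j).[c i]) *: F (peval u (c i * h)).

Definition hbvm (R : realType) (P : nat -> {poly R}) (k s : nat)
    (c b : 'I_k -> R) (n : nat) (F : 'cV[R]_n -> 'cV[R]_n) (y0 : 'cV[R]_n)
    (h : R) (u : 'cV[{poly R}]_n) : Prop :=
  [/\ forall i, (size (u i 0%R) <= s.+1)%N,
      peval u 0 = y0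
    & forall x : R, 0 <= x <= 1 ->
        peval (pderiv u) (x * h) =
        \sum_(j < s) (P j).[x] *: hbvm_gamma P c b F h u j].

(* U h is the polynomial produced by the method with stepsize h, for all small
   h > 0.  The equations of [hbvm] are implicit and, besides the solution that
   defines the method (the one close to y0), may have spurious solutions which
   blow up as h -> 0: for instance with k = s = 1 (the implicit midpoint rule)
   and f'(u) = - u^3.  Requiring the numerical solutions to stay bounded as h -> 0
   discards only the latter. *)
Definition hbvm_method (R : realType) (P : nat -> {poly R}) (k s : nat)
    (c b : 'I_k -> R) (n : nat) (F : 'cV[R]_n -> 'cV[R]_n) (y0 : 'cV[R]_n)
    (U : R -> 'cV[{poly R}]_n) : Prop :=
  (\forall h \near 0^'+, hbvm P s c b F y0 h (U h)) /\
  (exists M : R, \forall h \near 0^'+,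
     forall x : R, 0 <= x <= 1 -> `|peval (U h) (x * h)| <= M).

(* Main.v *)
(* With Q the Gauss quadrature of order 2k, the method says that the slope
   d(c) = u'(ch) is the discrete projection of F(u(ch)) on polynomials of degree
   < s: Q(q d) = Q(q F(u)) whenever deg q < s.

   Energy.  Write grad H = S F with S skew.  Then
   Q(<grad H(u), u'>) = Q(<S F(u), d>) = Q(<S d, d>) = 0, so H(y_1) - H(y_0) is h
   times the quadrature error for (d/dt) H(u) at t = ch: zero if H(u) is a
   polynomial of degree <= 2k, and O(h^(2k+1)) otherwise, because u turns out to
   have derivatives bounded uniformly in h (the j-th Legendre coefficient of d
   gains one power of h at a time, up to O(h^j), by inserting the Taylor
   expansion of F(u) into Q(P_j F(u))).

   Order.  The defect r = d - F(u) is O(h^s) and is orthogonal for Q to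
   polynomials of degree < s, hence int_0^1 V r dc = O(h^(2s)) for every smooth
   weight V(ch).  The error e = u - y satisfies e' = h (A e + r + O(e^2)), e(0) = 0,
   and e = O(h^(s+1)).  Instead of the resolvent, one integrates by parts:
   int w e = - int V (A e + r) + O(h^(2s)) with V' = h w, V(1) = 0.  Each step
   replaces the weight by one which is smaller by a power of h, so that
   int w e = O(h^(2s)), and e(1) = h int (A e + r) + ... = O(h^(2s+1)). *)
From HB Require Import structures.
From mathcomp Require Import ring lra zify.
Require Import Defs.
Set Implicit Arguments.
Unset Strict Implicit.
Unset Printing Implicit Defensive.
Local Open Scope classical_set_scope.
Local Open Scope ring_scope.

(** * Polynomial integration and Gauss-Legendre quadrature *)

Section PolyIntegral.
Variable R : realType.
Implicit Types p q : {poly R}.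

(** The primitive vanishing at 0: for [i = 0] the formula divides by 0, and the convention that the
    inverse of 0 is 0 gives the right constant term. *)
Definition prim p : {poly R} := \poly_(i < (size p).+1) (p`_i.-1 / i%:R).

Lemma coef_prim p i : (prim p)`_i = p`_i.-1 / i%:R.
Proof.
rewrite coef_poly; case: ltnP => // hi.
by rewrite nth_default ?mul0r// -ltnS (leq_trans hi)// leqSpred.
Qed.

Lemma prim_is_linear : linear prim.
Proof.
move=> a p q; apply/polyP => i.
by rewrite !(coef_prim, coefD, coefZ) mulrDl mulrA.
Qed.

HB.instance Definition _ :=
  GRing.isLinear.Build R {poly R} {poly R} _ prim prim_is_linear.

Lemma deriv_prim p : (prim p)^`() = p.
Proof.
apply/polyP => i; rewrite coef_deriv coef_prim -[LHS]mulr_natr divfK ?pnatr_eq0//.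
Qed.

Lemma size_prim p n : (size p <= n)%N -> (size (prim p) <= n.+1)%N.
Proof. by move=> pn; rewrite (leq_trans (size_poly _ _))// ltnS. Qed.

Lemma prim_horner0 p : (prim p).[0] = 0.
Proof. by rewrite horner_coef0 coef_prim invr0 mulr0. Qed.

Lemma prim_deriv p : prim p^`() = p - (p.[0])%:P.
Proof.
apply/polyP => i; rewrite coef_prim coef_deriv coefB coefC horner_coef0.
case: i => [|i] /=; first by rewrite invr0 mulr0 subrr.
by rewrite subr0 -[_ *+ i.+1]mulr_natr mulfK// pnatr_eq0.
Qed.

(** An algebraic integral over [0, 1], so that orthogonality and quadrature become linear algebra on
    coefficients. *)
Definition Int p : R := (prim p).[1].

Lemma Int_is_linear : linear_for *%R Int.
Proof. by move=> a p q; rewrite /Int linearP/= hornerD hornerZ. Qed.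

HB.instance Definition _ := GRing.isLinear.Build R {poly R} R _ Int Int_is_linear.

Lemma Int_deriv p : Int p^`() = p.[1] - p.[0].
Proof. by rewrite /Int prim_deriv !hornerE. Qed.

(** The fundamental theorem of calculus carries the Lebesgue integrals of [legendre_family] and
    [gauss_legendre] over to [Int]. *)
Lemma Rintegral_horner p :
  \int[lebesgue_measure]_(x in `[(0 : R), 1]) p.[x] = Int p.
Proof.
rewrite /Rintegral (@continuous_FTC2 R (horner p) (horner (prim p)) 0 1).
- by rewrite -EFinB /= prim_horner0 subr0.
- exact: ltr01.
- by apply: continuous_subspaceT => x; exact: continuous_horner.
- split; first by move=> x _; exact: derivable_horner.
    by apply: cvg_at_right_filter; exact: continuous_horner.
  by apply: cvg_at_left_filter; exact: continuous_horner.
- by move=> x _; rewrite -derivE deriv_prim.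
Qed.

Lemma Int_ge0 p : (forall x, 0 <= x <= 1 -> 0 <= p.[x]) -> 0 <= Int p.
Proof. by move=> p0; rewrite -Rintegral_horner; apply: Rintegral_ge0 => x /p0. Qed.

End PolyIntegral.

(** * Legendre expansions and exactness of the Gauss quadrature *)

Section Legendre.
Variables (R : realType) (P : nat -> {poly R}).
Hypothesis HP : legendre_family P.
Implicit Types p q : {poly R}.

Lemma size_legendre j : size (P j) = j.+1.
Proof. by case: HP. Qed.

Lemma legendre_orthonormal i j : Int (P i * P j) = (i == j)%:R.
Proof.
case: HP => _ <-; rewrite -Rintegral_horner.
by apply: eq_Rintegral => x _; rewrite hornerM.
Qed.

(** Since [P s] has degree exactly [s], subtracting a multiple of it removes the coefficient of
    degree [s], and induction applies. *)
Lemma legendre_span s q : (size q <= s)%N ->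
  exists a : 'I_s -> R, q = \sum_(j < s) a j *: P j.
Proof.
elim: s q => [|s IHs] q qs.
  by exists (fun _ => 0); rewrite big_ord0; apply/size_poly_leq0P.
have lP0 : lead_coef (P s) != 0.
  by rewrite lead_coef_eq0 -size_poly_eq0 size_legendre.
pose t := q`_s / lead_coef (P s).
have [|a qE] := IHs (q - t *: P s).
  apply/leq_sizeP => i; rewrite leq_eqVlt coefB coefZ => /predU1P[<-|si].
    have -> : (P s)`_s = lead_coef (P s) by rewrite lead_coefE size_legendre.
    by rewrite divfK ?subrr.
  rewrite [X in X - _]nth_default ?(leq_trans qs)// (nth_default _ (s := P s)) ?size_legendre//.
  by rewrite mulr0 subrr.
(* [insub] fails exactly at the last index, which receives the new coefficient [t]. *)
exists (fun i => if insub (i : nat) is Some j then a j else t).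
rewrite big_ord_recr/= insubF ?ltnn//.
by under eq_bigr => i _ do rewrite /= (valK i); rewrite -qE subrK.
Qed.

Lemma legendre_expansion s q : (size q <= s)%N ->
  q = \sum_(j < s) Int (P j * q) *: P j.
Proof.
move=> /legendre_span[a qE]; rewrite {1}qE; apply: eq_bigr => j _.
rewrite qE mulr_sumr linear_sum (bigD1 j)//= -scalerAr linearZ/=.
rewrite legendre_orthonormal eqxx mulr1 big1 ?addr0// => i ij.
by rewrite -scalerAr linearZ/= legendre_orthonormal eq_sym (inj_eq val_inj) (negPf ij) mulr0.
Qed.

Lemma legendre_orthogonal k q : (size q <= k)%N -> Int (P k * q) = 0.
Proof.
move=> /legendre_span[a ->]; rewrite mulr_sumr linear_sum big1// => i _.
by rewrite -scalerAr linearZ/= legendre_orthonormal gtn_eqF ?mulr0.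
Qed.

(** Parseval: the integral is the sum of the squared Legendre coefficients, which vanishes only if
    all of them do. *)
Lemma Int_sqr_gt0 q : q != 0 -> 0 < Int (q * q).
Proof.
move=> q0.
have [s [a qE]] : exists s (a : 'I_s -> R), q = \sum_(j < s) a j *: P j.
  by exists (size q); exact: legendre_span.
have -> : Int (q * q) = \sum_j a j ^+ 2.
  rewrite {1}qE mulr_suml linear_sum; apply: eq_bigr => j _ /=.
  rewrite -scalerAl linearZ/= qE mulr_sumr linear_sum (bigD1 j)//= -scalerAr linearZ/=.
  rewrite legendre_orthonormal eqxx mulr1 big1 ?addr0 ?expr2// => i ij.
  by rewrite -scalerAr linearZ/= legendre_orthonormal eq_sym (inj_eq val_inj) (negPf ij) mulr0.
rewrite lt_neqAle sumr_ge0 ?andbT; last by move=> i _; exact: sqr_ge0.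
apply: contra q0 => /eqP/esym/eqP.
rewrite psumr_eq0; last by move=> i _; exact: sqr_ge0.
move=> /allP a0; rewrite qE big1// => i _.
have := a0 i; rewrite mem_index_enum sqrf_eq0 => /(_ isT)/eqP ->.
by rewrite scale0r.
Qed.

Section Gauss.
Variables (k : nat) (c b : 'I_k -> R).
Hypothesis Hg : gauss_legendre P c b.

Definition quadrature (w : R -> R) : R := \sum_i b i * w (c i).

(** Write [P k] as [q] times x - c_i. As [q] has degree below [k], orthogonality makes the integral
    of (x - c_i) q^2 vanish, so c_i is the mean of x for the weight q^2 on [0, 1]. *)
Lemma node_itv i : 0 <= c i <= 1.
Proof.
case: Hg => _ /(_ i) /factor_theorem[q qE] _.
have q0 : q != 0.
  by apply: contraTneq isT => q0; move: (size_legendre k); rewrite qE q0 mul0r size_poly0.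
have sq : (size q <= k)%N.
  have := size_legendre k; rewrite qE size_Mmonic// ?monicXsubC//.
  by rewrite size_XsubC addn2 /= => -[->].
have := legendre_orthogonal sq; rewrite qE => I0.
have Iq := Int_sqr_gt0 q0.
have IX : 0 <= Int ('X * (q * q)).
  apply: Int_ge0 => x /andP[x0 _].
  by rewrite hornerM hornerX hornerM -expr2; apply: mulr_ge0 => //; exact: sqr_ge0.
have I1X : 0 <= Int ((1 - 'X) * (q * q)).
  apply: Int_ge0 => x /andP[_ x1].
  rewrite hornerM hornerD hornerN hornerX hornerC hornerM -expr2.
  by apply: mulr_ge0; rewrite ?subr_ge0 ?sqr_ge0.
have E1 : Int ('X * (q * q)) = c i * Int (q * q).
  apply/eqP; rewrite -subr_eq0 -I0 -[_ * Int _]linearZ -linearB /=.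
  by rewrite -mul_polyC; apply/eqP; congr Int; ring.
have E2 : Int ((1 - 'X) * (q * q)) = (1 - c i) * Int (q * q).
  by rewrite mulrBl mul1r linearB /= E1 mulrBl mul1r.
move: IX I1X; rewrite E1 E2 !pmulr_lge0// subr_ge0 => -> ->//.
Qed.

Lemma gauss_weight i :
  b i = Int (\prod_(j < k | j != i) ((c i - c j)^-1 *: ('X - (c j)%:P))).
Proof.
case: Hg => _ _ ->; rewrite -Rintegral_horner; apply: eq_Rintegral => x _.
by rewrite horner_prod; apply: eq_bigr => j _; rewrite !hornerE mulrC.
Qed.

Lemma quadratureD w v : quadrature (fun x => w x + v x) = quadrature w + quadrature v.
Proof. by rewrite /quadrature -big_split; apply: eq_bigr => i _ /=; rewrite mulrDr. Qed.

Lemma quadratureZ a w : quadrature (fun x => a * w x) = a * quadrature w.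
Proof. by rewrite /quadrature mulr_sumr; apply: eq_bigr => i _ /=; rewrite mulrCA. Qed.

Lemma quadratureB w v : quadrature (fun x => w x - v x) = quadrature w - quadrature v.
Proof. by rewrite /quadrature -sumrB; apply: eq_bigr => i _ /=; rewrite mulrBr. Qed.

Lemma quadrature_sum (I : Type) (r : seq I) (w : I -> R -> R) :
  quadrature (fun x => \sum_(i <- r) w i x) = \sum_(i <- r) quadrature (w i).
Proof. by rewrite /quadrature exchange_big; apply: eq_bigr => i _ /=; rewrite mulr_sumr. Qed.

Lemma eq_quadrature w v : (forall x, 0 <= x <= 1 -> w x = v x) -> quadrature w = quadrature v.
Proof. by move=> wv; apply: eq_bigr => i _; rewrite wv// node_itv. Qed.

(** Divide by [P k]. The multiple of [P k] has integral 0 by orthogonality and vanishes at the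
    nodes; the remainder, of degree below [k], equals its Lagrange interpolant, whose integral
    defines the weights. *)
Lemma gauss_exact p : (size p <= k + k)%N -> quadrature (horner p) = Int p.
Proof.
have [cinj croot _] := Hg.
move=> sp; have Pk0 : P k != 0 by rewrite -size_poly_eq0 size_legendre.
pose q := p %/ P k; pose r := p %% P k.
have pE : p = q * P k + r := divp_eq _ _.
have sq : (size q <= k)%N.
  by rewrite size_divp// size_legendre/= leq_subLR.
have sr : (size r <= k)%N.
  by rewrite -ltnS -(size_legendre k) ltn_modp.
pose L i : {poly R} := \prod_(j < k | j != i) ((c i - c j)^-1 *: ('X - (c j)%:P)).
have Lc i l : (L i).[c l] = (i == l)%:R.
  rewrite /L horner_prod; case: eqVneq => [<-|il].
    apply: big1 => j ji; rewrite !hornerE mulVf// subr_eq0.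
    by rewrite (inj_eq cinj) eq_sym.
  by rewrite (bigD1 l) 1?eq_sym//= !hornerE subrr mulr0 mul0r.
have rE : r = \sum_i r.[c i] *: L i.
  apply/eqP; rewrite -subr_eq0; apply/eqP.
  apply: (@roots_geq_poly_eq0 _ _ [seq c i | i <- enum 'I_k]).
  - apply/allP => _ /mapP[i _ ->]; rewrite /root hornerD hornerN horner_sum subr_eq0.
    apply/eqP; rewrite (bigD1 i)//= hornerZ Lc eqxx mulr1 big1 ?addr0// => j ji.
    by rewrite hornerZ Lc (negPf ji) mulr0.
  - by rewrite map_inj_uniq ?enum_uniq.
  - rewrite size_map size_enum_ord.
    rewrite (leq_trans (size_polyD _ _))// geq_max sr size_polyN.
    apply: (leq_trans (size_sum _ _ _)); apply/bigmax_leqP => i _.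
    rewrite (leq_trans (size_scale_leq _ _))//.
    rewrite /L (leq_trans (size_poly_prod_leq _ _))//.
    have ->: (\sum_(j < k | j != i) size ((c i - c j)^-1 *: ('X - (c j)%:P)%R))%N
      = (\sum_(j < k | j != i) 2)%N.
      apply: eq_bigr => j ji; rewrite size_scale ?size_XsubC//.
      by rewrite invr_eq0 subr_eq0 (inj_eq cinj) eq_sym.
    rewrite sum_nat_const muln2 -addnn.
    have -> : #|(fun j : 'I_k => j != i)| = k.-1.
      by have := cardC1 i; rewrite card_ord => <-; apply: eq_card.
    by rewrite subSn ?leq_addr// addKn prednK// (leq_trans _ (ltn_ord i)).
rewrite {2}pE linearD /= [X in Int X]mulrC legendre_orthogonal// add0r.
rewrite [in RHS]rE linear_sum; apply: eq_bigr => i _ /=.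
rewrite linearZ/= -/(L i) gauss_weight -/(L i) mulrC; congr (_ * _).
by rewrite pE !hornerE (eqP (croot i)) mulr0 add0r.
Qed.

End Gauss.
End Legendre.

(** * Mean value estimates and Taylor expansion *)

Section RealAnalysis.
Variable R : realType.
Implicit Types (g K : R -> R).

Lemma is_derive_derive1 g (x : R) : derivable g x 1 -> is_derive x 1 g (derive1 g x).
Proof. by move=> ?; apply: DeriveDef; rewrite ?derive1E. Qed.

Lemma mvt_le K K' (a b B : R) : a <= b ->
  (forall x, a < x < b -> is_derive x 1 K (K' x)) ->
  {within `[a, b], continuous K} ->
  (forall x, a < x < b -> `|K' x| <= B) ->
  `|K b - K a| <= B * (b - a).
Proof.
rewrite le_eqVlt => /predU1P[->|ab] dK cK KB; first by rewrite !subrr normr0 mulr0.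
have dK' x : x \in `]a, b[ -> is_derive x 1 K (K' x) by rewrite in_itv; exact: dK.
have [x + ->] := MVT ab dK' cK.
rewrite in_itv => xab; have ab0 : 0 < b - a by rewrite subr_gt0.
by rewrite normrM (gtr0_norm ab0) ler_pM2r// KB.
Qed.

Lemma mvt_abs_le g (a x B : R) : (forall z, derivable g z 1) ->
  (forall z, `|z - a| <= `|x - a| -> `|derive1 g z| <= B) ->
  `|g x - g a| <= B * `|x - a|.
Proof.
move=> dg gB.
have D (z : R) : is_derive z 1 g (derive1 g z) by exact: is_derive_derive1.
have C (u v : R) : {within `[u, v], continuous g}.
  by apply: derivable_within_continuous => z _; exact: dg.
have [ax|xa] := leP a x.
  have xa0 : 0 <= x - a by rewrite subr_ge0.
  have xaE := ger0_norm xa0; rewrite xaE in gB *.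
  apply: (@mvt_le g (derive1 g)) => // z /andP[az zx]; apply: gB.
  by rewrite ger0_norm ?subr_ge0 ?lerD2r// ltW.
have ax0 : 0 <= a - x by rewrite subr_ge0 ltW.
have xaE : `|x - a| = a - x by rewrite distrC ger0_norm.
rewrite xaE in gB *; rewrite distrC.
apply: (@mvt_le g (derive1 g)) => //; first exact: ltW.
move=> z /andP[xz za]; apply: gB.
by rewrite distrC ger0_norm ?subr_ge0 ?lerD2l ?lerN2 ltW.
Qed.

Lemma cont_diffS m g : cont_diff m.+1 g ->
  (forall x, derivable g x 1) /\ cont_diff m (derive1 g).
Proof.
move=> [dg cg]; split; first exact: (dg 0%N).
split; last by rewrite -derive1Sn.
by move=> n nm x; rewrite -derive1Sn; exact: (dg n.+1).
Qed.

Lemma cont_diff_continuous m g : cont_diff m g -> continuous g.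
Proof.
case: m => [[]//|m /cont_diffS[dg _] x].
exact/differentiable_continuous/derivable1_diffP.
Qed.

Lemma cont_diff_le m n g : (n <= m)%N -> cont_diff m g -> cont_diff n g.
Proof.
elim: n m g => [|n IHn] [|m] g // nm /[dup] gm.
  by move/cont_diff_continuous => cg; split.
move=> /cont_diffS[dg /(IHn _ _ nm)[dg' cg']].
split; last by rewrite derive1Sn.
case=> [|l] ln x; first exact: dg.
by rewrite derive1Sn; exact: dg'.
Qed.

Lemma continuous_bounded g (M : R) : continuous g ->
  exists C, forall x, `|x| <= M -> `|g x| <= C.
Proof.
move=> cg; have [M0|M0] := leP 0 M; last first.
  by exists 0 => x /le_lt_trans/(_ M0); rewrite normr_lt0.
have MM : - M <= M by rewrite (le_trans _ M0)// oppr_le0.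
have cw (f : R -> R) : continuous f -> {within `[- M, M], continuous f}.
  by move=> cf; apply: continuous_subspaceT => x; exact: cf.
have [a _ ga] := EVT_max MM (cw _ cg).
have [b _ gb] := EVT_min MM (cw _ cg).
exists (`|g a| + `|g b|) => x; rewrite ler_norml => xM.
have xI : x \in `[- M, M] by rewrite in_itv.
rewrite ler_norml; apply/andP; split.
  rewrite lerNl (le_trans (y := `|g b|)) ?lerDr// -normrN.
  by rewrite (le_trans _ (ler_norm _))// lerN2 gb.
by rewrite (le_trans (ga x xI))// (le_trans (ler_norm _))// lerDl.
Qed.

(** Induction integrates the expansion of [derive1 g], and the mean value theorem gains one power of
    |x - a|. Local boundedness starts the induction. *)
Lemma taylor n g (a : R) : cont_diff n g ->
  exists (p : {poly R}) (C : R), forall x, `|x - a| <= 1 ->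
    `|g x - p.[x - a]| <= C * `|x - a| ^+ n.
Proof.
elim: n g => [|n IHn] g.
  move=> /cont_diff_continuous cg.
  have [C gC] := continuous_bounded (1 + `|a|) cg.
  exists 0, C => x xa; rewrite hornerC subr0 expr0 mulr1 gC//.
  by rewrite -[x](subrK a) (le_trans (ler_normD _ _))// lerD2r.
move=> /cont_diffS[dg /IHn[p [C gp]]].
pose q := prim p; have q' : q^`() = p by exact: deriv_prim.
pose f x := g x - q.[x - a].
have df (x : R) : is_derive x 1 f (derive1 g x - p.[x - a]).
  have dgx := is_derive_derive1 (dg x).
  have -> : f = g - horner (q \Po ('X - a%:P)).
    by apply/funext => y; rewrite /f !fctE horner_comp !hornerE.
  have -> : p.[x - a] = (q \Po ('X - a%:P))^`().[x].
    by rewrite deriv_comp q' derivXsubC mulr1 horner_comp !hornerE.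
  exact: is_deriveB.
have df' x : derive1 f x = derive1 g x - p.[x - a] by rewrite derive1E derive_val.
exists (q + (g a - q.[0])%:P), C => x xa.
have -> : g x - (q + (g a - q.[0])%:P).[x - a] = f x - f a.
  by rewrite /f hornerD hornerC subrr; ring.
rewrite exprSr mulrA; apply: mvt_abs_le => [//|z za].
rewrite df' (le_trans (gp _ (le_trans za xa)))// ler_wpM2l ?lerXn2r ?nnegrE//.
(* What remains is [0 <= C]; it follows from the bound at [a + 1], where the power equals 1. *)
have /le_trans/(_ (gp (a + 1) _)) : 0 <= `|derive1 g (a + 1) - p.[a + 1 - a]| by [].
rewrite addrAC subrr add0r normr1 expr1n mulr1; exact.
Qed.

(** Two mean value estimates: g minus its tangent at x has derivative g'(w) - g'(x), which is O(|w -
    x|). Points w between x and z satisfy |w| <= |x| + |z - x| <= 3M, whence the radius [3 * M]. *)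
Lemma linearisation g (M : R) : cont_diff 2 g ->
  exists C, forall x z, `|x| <= M -> `|z| <= M ->
    `|g x - g z - derive1 g x * (x - z)| <= C * (x - z) ^+ 2.
Proof.
move=> /cont_diffS[dg /cont_diffS[dg' /cont_diff_continuous cg]].
have [C gC] := continuous_bounded (3 * M) cg.
exists C => x z xM zM.
have near_x w : `|w - x| <= `|z - x| -> `|w| <= 3 * M.
  move=> wx; rewrite -[w](subrK x) (le_trans (ler_normD _ _))//.
  have := le_trans wx (ler_normB _ _); lra.
pose f w := g w - derive1 g x * (w - x).
have df (w : R) : is_derive w 1 f (derive1 g w - derive1 g x).
  have dgw := is_derive_derive1 (dg w).
  have -> : f = g - horner ((derive1 g x) *: ('X - x%:P)).
    by apply/funext => y; rewrite /f !fctE !hornerE.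
  apply: trigger_derive; congr (_ - _).
  by rewrite derivZ derivXsubC !hornerE.
have H : `|f z - f x| <= C * `|z - x| * `|z - x|.
  apply: mvt_abs_le => [//|w wz].
  have -> : derive1 f w = derive1 g w - derive1 g x by rewrite derive1E derive_val.
  rewrite (le_trans (y := C * `|w - x|))//.
    apply: mvt_abs_le => // v vx; apply: gC; apply: near_x; exact: le_trans wz.
  by rewrite ler_wpM2l// (le_trans _ (gC x _))// near_x// subrr normr0.
have -> : g x - g z - derive1 g x * (x - z) = - (f z - f x) by rewrite /f subrr; ring.
rewrite normrN (le_trans H)// -mulrA -expr2 real_normK ?num_real//.
by rewrite -(opprB x) sqrrN.
Qed.
End RealAnalysis.

(** * Families indexed by the stepsize *)

Section Families.
Variable R : realType.
Implicit Types (w v : R -> R -> R) (p q : R -> {poly R}) (n m l : nat).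

Lemma near_le1 : \forall h \near (0 : R)^'+, 0 < h <= 1.
Proof.
by near=> h; apply/andP; split; near: h; [exact: nbhs_right_gt|exact: nbhs_right_le].
Unshelve. all: end_near. Qed.

(* A family [w h c] is seen at the time t = c h of a step of size h -> 0+, with
   c in [0, 1]. *)
Definition unifO n w := exists C : R, \forall h \near 0^'+,
  forall c, 0 <= c <= 1 -> `|w h c| <= C * h ^+ n.

Lemma unifO_pos n w : unifO n w -> exists2 C, 0 <= C &
  \forall h \near 0^'+, 0 < h <= 1 /\
    forall c, 0 <= c <= 1 -> `|w h c| <= C * h ^+ n.
Proof.
move=> [C wC]; exists `|C| => //.
apply: filterS2 near_le1 wC => h /[dup] h01 /andP[h0 _] wC; split => // c /wC wc.
by rewrite (le_trans wc)// ler_wpM2r ?exprn_ge0 ?ler_norm// ltW.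
Qed.

Lemma eq_unifO n w v :
  (\forall h \near 0^'+, forall c, 0 <= c <= 1 -> w h c = v h c) ->
  unifO n v -> unifO n w.
Proof.
move=> wv [C vC]; exists C; apply: filterS2 wv vC => h wv vC c c01.
by rewrite wv// vC.
Qed.

Lemma unifO_le n m w : (m <= n)%N -> unifO n w -> unifO m w.
Proof.
move=> mn /unifO_pos[C C0 wC]; exists C; apply: filterS wC => h [/andP[h0 h1] wC] c /wC wc.
by rewrite (le_trans wc)// ler_wpM2l// ler_wiXn2l// ltW.
Qed.

Lemma unifOD n w v : unifO n w -> unifO n v -> unifO n (fun h c => w h c + v h c).
Proof.
move=> [C wC] [D vD]; exists (C + D); apply: filterS2 wC vD => h wC vD c c01.
by rewrite mulrDl (le_trans (ler_normD _ _))// lerD ?wC ?vD.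
Qed.

Lemma unifON n w : unifO n w -> unifO n (fun h c => - w h c).
Proof.
by move=> [C wC]; exists C; apply: filterS wC => h wC c c01; rewrite normrN wC.
Qed.

Lemma unifOB n w v : unifO n w -> unifO n v -> unifO n (fun h c => w h c - v h c).
Proof. by move=> wn vn; apply: unifOD => //; exact: unifON. Qed.

Lemma unifOM n m w v : unifO n w -> unifO m v ->
  unifO (n + m) (fun h c => w h c * v h c).
Proof.
move=> /unifO_pos[C C0 wC] /unifO_pos[D D0 vD]; exists (C * D).
apply: filterS2 wC vD => h [_ wC] [_ vD] c c01.
by rewrite exprD mulrACA normrM ler_pM// ?wC ?vD.
Qed.

Lemma unifO_pow n : unifO n (fun h _ => h ^+ n).
Proof.
exists 1; apply: filterS near_le1 => h /andP[h0 _] c _.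
by rewrite mul1r ger0_norm// exprn_ge0// ltW.
Qed.

Lemma unifO_cst (a : R) : unifO 0 (fun _ _ => a).
Proof. by exists `|a|; apply: nearW => h c _; rewrite mulr1. Qed.

Lemma unifO0 n : unifO n (fun _ _ => 0).
Proof. by exists 0; apply: nearW => h c _; rewrite normr0 mul0r. Qed.

Lemma unifOZ n (a : R) w : unifO n w -> unifO n (fun h c => a * w h c).
Proof. by move=> wn; rewrite -[n]add0n; apply: unifOM => //; exact: unifO_cst. Qed.

Lemma unifO_sum n (I : Type) (r : seq I) (w : I -> R -> R -> R) :
  (forall i, unifO n (w i)) -> unifO n (fun h c => \sum_(i <- r) w i h c).
Proof.
move=> wn; elim: r => [|i r IHr].
  by under [X in unifO n X]eq_fun => h do under eq_fun => c do rewrite big_nil; exact: unifO0.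
under [X in unifO n X]eq_fun => h do under eq_fun => c do rewrite big_cons.
exact: unifOD.
Qed.

(* For l = 0, [p h] evaluated at c is a polynomial in the unscaled time c h whose
   coefficients are bounded as h -> 0. *)
Definition graded l p := exists (C : R) (d : nat), \forall h \near 0^'+,
  (size (p h) <= d)%N /\ forall i, `|(p h)`_i| <= C * h ^+ maxn i l.

Lemma graded_pos l p : graded l p -> exists2 C : R, 0 <= C & exists d : nat,
  \forall h \near 0^'+, [/\ 0 < h <= 1, (size (p h) <= d)%N &
    forall i, `|(p h)`_i| <= C * h ^+ maxn i l].
Proof.
move=> [C [d pC]]; exists `|C| => //; exists d.
apply: filterS2 near_le1 pC => h /[dup] h01 /andP[h0 _] [sp pC]; split => // i.
by rewrite (le_trans (pC i))// ler_wpM2r ?exprn_ge0 ?ler_norm// ltW.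
Qed.

Lemma gradedD l p q : graded l p -> graded l q -> graded l (fun h => p h + q h).
Proof.
move=> [C [d pC]] [D [e qD]]; exists (C + D), (maxn d e).
apply: filterS2 pC qD => h [sp pC] [sq qD]; split=> [|i].
  rewrite (leq_trans (size_polyD _ _))// geq_max (leq_trans sp) ?leq_maxl//=.
  by rewrite (leq_trans sq) ?leq_maxr.
by rewrite coefD mulrDl (le_trans (ler_normD _ _))// lerD.
Qed.

(** In the convolution max(j, l) + (i - j) >= max(i, l), so a factor of level 0 preserves the level
    of the other. There are at most [d + e] terms, whence the constant. *)
Lemma gradedM l p q : graded l p -> graded 0 q -> graded l (fun h => p h * q h).
Proof.
move=> /graded_pos[C C0 [d pC]] /graded_pos[D D0 [e qD]].
exists ((d + e)%:R * (C * D)), (d + e)%N.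
apply: filterS2 pC qD => h [/andP[h0 h1] sp pC] [_ sq qD].
have spq : (size (p h * q h)%R <= d + e)%N.
  by rewrite (leq_trans (size_polyMleq _ _))// (leq_trans (leq_pred _))// leq_add.
split=> // i; have [ide|dei] := ltnP i (d + e); last first.
  rewrite nth_default ?(leq_trans spq)// normr0.
  by rewrite !mulr_ge0// exprn_ge0// ltW.
rewrite coefM (le_trans (ler_norm_sum _ _ _))//.
apply: (@le_trans _ _ (\sum_(j < i.+1) C * D * h ^+ maxn i l)).
  apply: ler_sum => j _; rewrite normrM.
  apply: (@le_trans _ _ ((C * h ^+ maxn j l) * (D * h ^+ maxn (i - j) 0))).
    by rewrite ler_pM.
  rewrite mulrACA -exprD ler_wpM2l ?mulr_ge0// ler_wiXn2l// ?(ltW h0)//.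
  have ji : (j <= i)%N by rewrite -ltnS.
  rewrite maxn0 geq_max -{1}(subnKC ji) leq_add2r leq_maxl /=.
  by rewrite (leq_trans (leq_maxr j l))// leq_addr.
rewrite sumr_const card_ord -[X in X <= _]mulr_natl mulrA ler_wpM2r ?exprn_ge0  ?(ltW h0)//.
by rewrite ler_wpM2r ?mulr_ge0// ler_nat.
Qed.

Lemma gradedC l (a : R -> R) : unifO l (fun h _ => a h) -> graded l (fun h => (a h)%:P).
Proof.
move=> /unifO_pos[C C0 aC]; exists C, 1%N; apply: filterS aC => h [/andP[h0 h1] aC].
split=> [|i]; first exact: size_polyC_leq1.
rewrite coefC; case: eqP => [->|_]; first by rewrite max0n (aC 0)// lexx ler01.
by rewrite normr0 mulr_ge0 ?exprn_ge0// ltW.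
Qed.

Lemma graded_sum l (I : Type) (r : seq I) (p : I -> R -> {poly R}) :
  (forall i, graded l (p i)) -> graded l (fun h => \sum_(i <- r) p i h).
Proof.
move=> pl; elim: r => [|i r IHr].
  exists 0, 0%N; apply: nearW => h; rewrite big_nil size_poly0; split=> // i.
  by rewrite coef0 normr0 mul0r.
under [X in graded l X]eq_fun => h do rewrite big_cons.
exact: gradedD.
Qed.

Lemma graded_le l m p : (m <= l)%N -> graded l p -> graded m p.
Proof.
move=> ml /graded_pos[C C0 [d pC]]; exists C, d.
apply: filterS pC => h [/andP[h0 h1] sp pC]; split=> // i; rewrite (le_trans (pC i))//.
rewrite ler_wpM2l// ler_wiXn2l ?(ltW h0)// geq_max leq_maxl/= (leq_trans ml)//.
exact: leq_maxr.
Qed.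

Lemma graded_unifO l p : graded l p -> unifO l (fun h c => (p h).[c]).
Proof.
move=> /graded_pos[C C0 [d pC]]; exists (d%:R * C).
apply: filterS pC => h [/andP[h0 h1] sp pC] c /andP[c0 c1].
rewrite (horner_coef_wide _ sp) (le_trans (ler_norm_sum _ _ _))//.
apply: (@le_trans _ _ (\sum_(i < d) C * h ^+ l)).
  apply: ler_sum => i _; rewrite normrM -[X in _ <= X]mulr1 ler_pM//.
    rewrite (le_trans (pC i))// ler_wpM2l// ler_wiXn2l ?leq_maxr ?(ltW h0)//.
  by rewrite ger0_norm ?exprn_ge0// exprn_ile1.
by rewrite sumr_const card_ord -[X in X <= _]mulr_natl mulrA.
Qed.

Lemma graded_take l m p : graded l p -> graded l (fun h => take_poly m (p h)).
Proof.
move=> /graded_pos[C C0 [d pC]]; exists C, d.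
apply: filterS pC => h [/andP[h0 h1] sp pC]; split=> [|i].
  apply/leq_sizeP => i di; rewrite coef_take_poly nth_default ?if_same//.
  exact: leq_trans di.
rewrite coef_take_poly; case: ifP => // _.
by rewrite normr0 mulr_ge0 ?exprn_ge0// ltW.
Qed.

(** The discarded coefficients have index at least [m], hence are O(h^m). *)
Lemma graded_trunc l m p : graded l p ->
  unifO m (fun h c => (p h).[c] - (take_poly m (p h)).[c]).
Proof.
move=> /graded_pos[C C0 [d pC]].
have : graded m (fun h => p h - take_poly m (p h)).
  exists C, (maxn d m); apply: filterS pC => h [/andP[h0 h1] sp pC]; split=> [|i].
    rewrite (leq_trans (size_polyD _ _))// size_polyN geq_max (leq_trans sp) ?leq_maxl//=.
    by rewrite (leq_trans (size_take_poly _ _)) ?leq_maxr.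
  rewrite coefB coef_take_poly; case: ltnP => im.
    by rewrite subrr normr0 mulr_ge0 ?exprn_ge0// ltW.
  by rewrite subr0 (le_trans (pC i))// ler_wpM2l// ler_wiXn2l ?(ltW h0)// leq_maxl.
move=> /graded_unifO; apply: eq_unifO; apply: nearW => h c _.
by rewrite hornerD hornerN.
Qed.

(** A Taylor expansion of order n in the time c h, uniform in h. It plays the role of n derivatives
    bounded uniformly in h, but only asks for values of the family. *)
Definition scaled n w := exists2 p, graded 0 p &
  unifO n (fun h c => w h c - (p h).[c]).

Lemma graded_scaled n p : graded 0 p -> scaled n (fun h c => (p h).[c]).
Proof.
exists p => //; under [X in unifO n X]eq_fun => h do under eq_fun => c do rewrite subrr.
exact: unifO0.
Qed.

Lemma unifO_scaled n w : unifO n w -> scaled n w.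
Proof.
move=> wn; exists (fun _ => 0%:P); first exact/gradedC/unifO_cst.
by apply: eq_unifO wn; apply: nearW => h c _; rewrite hornerC subr0.
Qed.

Lemma eq_scaled n w v :
  (\forall h \near 0^'+, forall c, 0 <= c <= 1 -> w h c = v h c) ->
  scaled n v -> scaled n w.
Proof.
move=> wv [p p0 vp]; exists p => //; apply: eq_unifO vp.
by apply: filterS wv => h wv c c01; rewrite wv.
Qed.

Lemma scaled_le n m w : (m <= n)%N -> scaled n w -> scaled m w.
Proof. by move=> mn [p p0 wp]; exists p => //; exact: unifO_le wp. Qed.

Lemma scaled_unifO n w : scaled n w -> unifO 0 w.
Proof.
move=> [p /graded_unifO p0 /(unifO_le (leq0n n)) wp].
apply: eq_unifO (unifOD wp p0); apply: nearW => h c _.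
by rewrite subrK.
Qed.

(** The degree bound, valid for every h, is what makes the approximating polynomial accessible to
    exact quadrature and orthogonality. *)
Lemma scaled_trunc n w : scaled n w -> exists p, [/\ graded 0 p,
  forall h, (size (p h) <= n)%N & unifO n (fun h c => w h c - (p h).[c])].
Proof.
move=> [p p0 wp]; exists (fun h => take_poly n (p h)); split.
- exact: graded_take.
- by move=> h; exact: size_take_poly.
- apply: eq_unifO (unifOD wp (graded_trunc n p0)); apply: nearW => h c _.
  by rewrite subrKA.
Qed.

Lemma scaledD n w v : scaled n w -> scaled n v -> scaled n (fun h c => w h c + v h c).
Proof.
move=> [p p0 wp] [q q0 vq]; exists (fun h => p h + q h); first exact: gradedD.
apply: eq_unifO (unifOD wp vq); apply: nearW => h c _; rewrite hornerD; ring.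
Qed.

Lemma scaledM n w v : scaled n w -> scaled n v -> scaled n (fun h c => w h c * v h c).
Proof.
move=> [p p0 wp] /[dup] vn [q q0 vq]; exists (fun h => p h * q h); first exact: gradedM.
have := unifOD (unifOM wp (scaled_unifO vn)) (unifOM vq (graded_unifO p0)).
rewrite addn0; apply: eq_unifO; apply: nearW => h c _; rewrite hornerM; ring.
Qed.

Lemma scaled_cst n (a : R) : scaled n (fun _ _ => a).
Proof.
have : graded 0 (fun _ => a%:P) by apply: gradedC; exact: unifO_cst.
by move=> /(graded_scaled n); apply: eq_scaled; apply: nearW => h c _; rewrite hornerC.
Qed.

Lemma scaledZ n (a : R) w : scaled n w -> scaled n (fun h c => a * w h c).
Proof. by move=> wn; apply: scaledM => //; exact: scaled_cst. Qed.

Lemma scaledB n w v : scaled n w -> scaled n v -> scaled n (fun h c => w h c - v h c).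
Proof.
move=> wn vn; apply: eq_scaled (scaledD wn (scaledZ (-1) vn)).
by apply: nearW => h c _; rewrite mulN1r.
Qed.

Lemma scaled_sum n (I : Type) (r : seq I) (w : I -> R -> R -> R) :
  (forall i, scaled n (w i)) -> scaled n (fun h c => \sum_(i <- r) w i h c).
Proof.
move=> wn; elim: r => [|i r IHr].
  by under [X in scaled n X]eq_fun => h do under eq_fun => c do rewrite big_nil; exact: scaled_cst.
under [X in scaled n X]eq_fun => h do under eq_fun => c do rewrite big_cons.
exact: scaledD.
Qed.

Lemma scaled_horner n (q : {poly R}) w : scaled n w -> scaled n (fun h c => q.[w h c]).
Proof.
move=> wn; elim/poly_ind: q => [|q a IHq].
  by apply: eq_scaled (scaled_cst n 0); apply: nearW => h c _; rewrite hornerC.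
apply: eq_scaled (scaledD (scaledM IHq wn) (scaled_cst n a)).
by apply: nearW => h c _; rewrite hornerD hornerM hornerX hornerC.
Qed.

(** The Taylor polynomial of [g] at [a] preserves expansions, and the Taylor remainder is O(h^n)
    because [w] stays within O(h) of [a]. *)
Lemma scaled_comp n (g : R -> R) (a : R) w : cont_diff n g ->
  scaled n w -> unifO 1 (fun h c => w h c - a) -> scaled n (fun h c => g (w h c)).
Proof.
move=> /(@taylor _ _ _ a)[q [C gq]] wn wa.
have gqn : unifO n (fun h c => g (w h c) - q.[w h c - a]).
  have /unifO_pos[D D0 wD] := wa; exists (`|C| * D ^+ n).
  (* For such h one has [D * h <= 1], so that [w] lies in the unit neighbourhood of [a] where the
     Taylor estimate holds. *)
  have hD : \forall h \near (0 : R)^'+, h <= (D + 1)^-1.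
    by apply: nbhs_right_le; rewrite invr_gt0 ltr_wpDl.
  apply: filterS2 wD hD => h [/andP[h0 h1] wD] hD c c01.
  have wDc := wD c c01; rewrite expr1 in wDc.
  have Dh : D * h <= 1.
    rewrite (le_trans (y := (D + 1) * h)) ?ler_wpM2r ?lerDl  ?(ltW h0)//.
    by rewrite -ler_pdivlMl ?mulr1// ltr_wpDl.
  rewrite (le_trans (gq _ (le_trans wDc Dh)))// -mulrA -exprMn.
  apply: (@le_trans _ _ (`|C| * `|w h c - a| ^+ n)).
    by rewrite ler_wpM2r ?exprn_ge0// ler_norm.
  by rewrite ler_wpM2l// lerXn2r ?nnegrE// mulr_ge0// ltW.
have := scaledD (unifO_scaled gqn) (scaled_horner q (scaledB wn (scaled_cst n a))).
by apply: eq_scaled; apply: nearW => h c _; rewrite subrK.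
Qed.

End Families.

(** * Derivatives of explicit expressions and mean value bounds on [0, 1] *)

Section PointwiseDerive.
Variable R : realType.
Implicit Types f g : R -> R.

Lemma is_deriveD_fun f g (t a b : R) : is_derive t 1 f a -> is_derive t 1 g b ->
  is_derive t 1 (fun x => f x + g x) (a + b).
Proof. exact: is_deriveD. Qed.

Lemma is_deriveM_fun f g (t a b : R) : is_derive t 1 f a -> is_derive t 1 g b ->
  is_derive t 1 (fun x => f x * g x) (a * g t + f t * b).
Proof.
move=> Df Dg; have -> : a * g t + f t * b = f t *: b + g t *: a.
  by rewrite /GRing.scale/= addrC [g t * a]mulrC.
exact: is_deriveM.
Qed.

Lemma is_derive_cst_fun (t a : R) : is_derive t 1 (fun _ : R => a) (0 : R).
Proof. exact: is_derive_cst. Qed.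

Lemma is_deriveZ_fun f (t a c : R) : is_derive t 1 f a ->
  is_derive t 1 (fun x => c * f x) (c * a).
Proof.
move=> Df; have := is_deriveM_fun (is_derive_cst_fun t c) Df.
by rewrite mul0r add0r.
Qed.

Lemma is_derive_sum_fun (I : Type) (r : seq I) (f : I -> R -> R) (t : R) (a : I -> R) :
  (forall i, is_derive t 1 (f i) (a i)) ->
  is_derive t 1 (fun x => \sum_(i <- r) f i x) (\sum_(i <- r) a i).
Proof.
move=> Df; elim: r => [|i r IHr].
  under eq_fun do rewrite big_nil; rewrite big_nil; exact: is_derive_cst_fun.
under eq_fun do rewrite big_cons; rewrite big_cons; exact: is_deriveD_fun.
Qed.

Lemma is_derive_comp_fun f g (t a b : R) : is_derive (g t) 1 f a -> is_derive t 1 g b ->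
  is_derive t 1 (fun x => f (g x)) (a * b).
Proof. by move=> Df Dg; apply: is_derive1_comp. Qed.

(** A derivative inside and continuity up to the ends: this is what the mean value theorem takes,
    and what a solution that is merely right continuous at 0 provides. *)
Definition C1_01 f (f' : R -> R) :=
  (forall t : R, 0 < t < 1 -> is_derive t 1 f (f' t)) /\
  {within `[(0 : R), 1], continuous f}.

Lemma C1_01D f f' g g' : C1_01 f f' -> C1_01 g g' ->
  C1_01 (fun x => f x + g x) (fun x => f' x + g' x).
Proof.
move=> [Df cf] [Dg cg]; split=> [t t01|]; first exact: is_deriveD_fun (Df t t01) (Dg t t01).
by move=> x; apply: cvgD; [exact: cf|exact: cg].
Qed.

Lemma C1_01M f f' g g' : C1_01 f f' -> C1_01 g g' ->
  C1_01 (fun x => f x * g x) (fun x => f' x * g x + f x * g' x).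
Proof.
move=> [Df cf] [Dg cg]; split=> [t t01|]; first exact: is_deriveM_fun (Df t t01) (Dg t t01).
by move=> x; apply: cvgM; [exact: cf|exact: cg].
Qed.

Lemma C1_01_poly (p : {poly R}) : C1_01 (horner p) (horner p^`()).
Proof.
split=> [t _|]; first exact: is_derive_poly.
by apply: continuous_subspaceT => x; exact: continuous_horner.
Qed.

Lemma C1_01_cst (a : R) : C1_01 (fun=> a) (fun=> 0).
Proof.
split=> [t _|]; first exact: is_derive_cst_fun.
by apply: continuous_subspaceT => x; exact: cst_continuous.
Qed.

Lemma C1_01Z f f' (a : R) : C1_01 f f' -> C1_01 (fun x => a * f x) (fun x => a * f' x).
Proof.
move=> Cf; have := C1_01M (C1_01_cst a) Cf.
by rewrite (_ : (fun x => 0 * f x + a * f' x) = (fun x => a * f' x))//;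
   apply/funext => x; rewrite mul0r add0r.
Qed.

Lemma C1_01B f f' g g' : C1_01 f f' -> C1_01 g g' ->
  C1_01 (fun x => f x - g x) (fun x => f' x - g' x).
Proof.
move=> Cf /(C1_01Z (-1)) Cg; have := C1_01D Cf Cg.
by under eq_fun do rewrite mulN1r; under [X in C1_01 _ X]eq_fun do rewrite mulN1r.
Qed.

Lemma C1_01_sum (I : Type) (r : seq I) (f f' : I -> R -> R) :
  (forall i, C1_01 (f i) (f' i)) ->
  C1_01 (fun x => \sum_(i <- r) f i x) (fun x => \sum_(i <- r) f' i x).
Proof.
move=> Cf; elim: r => [|i r IHr].
  under eq_fun do rewrite big_nil; under [X in C1_01 _ X]eq_fun do rewrite big_nil.
  exact: C1_01_cst.
under eq_fun do rewrite big_cons; under [X in C1_01 _ X]eq_fun do rewrite big_cons.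
exact: C1_01D.
Qed.

Lemma C1_01_mvt f f' (B t : R) : C1_01 f f' ->
  (forall x, 0 <= x <= 1 -> `|f' x| <= B) -> 0 <= t <= 1 -> `|f t - f 0| <= B.
Proof.
move=> [Df cf] fB /andP[t0 t1].
have B0 : 0 <= B by rewrite (le_trans _ (fB 0 _))// lexx ler01.
rewrite (le_trans (@mvt_le _ f f' 0 t B t0 _ _ _))//.
- move=> x /andP[x0 xt]; apply: Df; rewrite x0/=; exact: lt_le_trans t1.
- apply: continuous_subspaceW cf => x /=; rewrite !in_itv/= => /andP[-> xt] /=.
  exact: le_trans t1.
- by move=> x /andP[x0 xt]; apply: fB; rewrite !ltW// (lt_le_trans xt).
- by rewrite subr0 ler_piMr.
Qed.

(** Stands in for integration over the step: increments of a primitive are bounded instead of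
    integrals, so integrability never has to be discussed. *)
Lemma unifO_mvt m (f f' : R -> R -> R) :
  (\forall h \near 0^'+, C1_01 (f h) (f' h)) -> unifO m f' ->
  unifO m (fun h t => f h t - f h 0).
Proof.
move=> Cf [C fC]; exists C; apply: filterS2 Cf fC => h Cf fC t t01.
exact: C1_01_mvt Cf fC t01.
Qed.

Lemma unifO_at m (f : R -> R -> R) (a : R) : 0 <= a <= 1 -> unifO m f ->
  unifO m (fun h _ => f h a).
Proof. by move=> a01 [C fC]; exists C; apply: filterS fC => h fC t _; exact: fC. Qed.

(** Summing the absolute values gives one constant and one range of h for all components. *)
Lemma unifO_unif (n m : nat) (w : 'I_n -> R -> R -> R) :
  (forall j, unifO m (w j)) -> exists2 C : R, 0 <= C & \forall h \near 0^'+,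
    forall t, 0 <= t <= 1 -> forall j, `|w j h t| <= C * h ^+ m.
Proof.
move=> wm.
have : unifO m (fun h t => \sum_j `|w j h t|).
  apply: unifO_sum => j; have [C wC] := wm j; exists C.
  by apply: filterS wC => h wC t /wC; rewrite normr_id.
move=> /unifO_pos[C C0 wC]; exists C => //; apply: filterS wC => h [_ wC] t /wC wt j.
rewrite (le_trans _ wt)// (le_trans _ (ler_norm _))// (bigD1 j)//= lerDl.
exact: sumr_ge0.
Qed.

End PointwiseDerive.

(** * The discrete projection identity *)

Section SingleStep.
Variables (R : realType) (P : nat -> {poly R}) (k s : nat) (c b : 'I_k -> R).
Hypotheses (HP : legendre_family P) (Hg : gauss_legendre P c b) (sk : (s <= k)%N).
Variables (n : nat) (F : 'cV[R]_n -> 'cV[R]_n) (y0 : 'cV[R]_n).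
Local Notation Q := (quadrature c b).

Definition slope (h : R) (u : 'cV[{poly R}]_n) (i : 'I_n) : {poly R} :=
  \sum_(j < s) hbvm_gamma P c b F h u j i 0 *: P j.

Lemma size_slope h u i : (size (slope h u i) <= s)%N.
Proof.
apply: (leq_trans (size_sum _ _ _)); apply/bigmax_leqP => j _.
by rewrite (leq_trans (size_scale_leq _ _))// size_legendre.
Qed.

Lemma hbvm_gammaE h u j i :
  hbvm_gamma P c b F h u j i 0 = Q (fun x => (P j).[x] * F (peval u (x * h)) i 0).
Proof.
by rewrite /hbvm_gamma summxE; apply: eq_bigr => l _; rewrite mxE mulrA.
Qed.

Lemma gauss_exactM (p q : {poly R}) : (size p <= k)%N -> (size q <= k)%N ->
  Q (fun x => p.[x] * q.[x]) = Int (p * q).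
Proof.
move=> pk qk; rewrite -(gauss_exact HP Hg).
  by apply: eq_bigr => i _; rewrite hornerM.
rewrite (leq_trans (size_polyMleq _ _))// (leq_trans (leq_pred _))//.
exact: leq_add.
Qed.

(** By linearity it suffices to test against [P j] with j < s. There the quadrature is exact on the
    left, and orthonormality extracts the coefficient [hbvm_gamma], which is the right-hand side. *)
Lemma slope_projection h u i (q : {poly R}) : (size q <= s)%N ->
  Q (fun x => q.[x] * (slope h u i).[x]) =
  Q (fun x => q.[x] * F (peval u (x * h)) i 0).
Proof.
move=> qs; rewrite gauss_exactM ?(leq_trans _ sk) ?size_slope//.
rewrite [RHS](_ : _ = \sum_(j < s) Int (P j * q) *
   Q (fun x => (P j).[x] * F (peval u (x * h)) i 0)).
  rewrite /slope mulr_sumr linear_sum; apply: eq_bigr => j _ /=.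
  by rewrite -scalerAr linearZ /= hbvm_gammaE mulrC [q * _]mulrC.
under [RHS]eq_bigr => j _ do rewrite -quadratureZ.
rewrite -quadrature_sum; apply: eq_bigr => l _; congr (_ * _).
rewrite {1}(legendre_expansion HP qs) horner_sum mulr_suml.
by apply: eq_bigr => j _; rewrite hornerZ mulrA.
Qed.

Section Hbvm.
Variables (h : R) (u : 'cV[{poly R}]_n).
Hypothesis Hu : hbvm P s c b F y0 h u.

Lemma slopeE i x : 0 <= x <= 1 -> (u i 0)^`().[x * h] = (slope h u i).[x].
Proof.
case: Hu => _ _ /[apply] /matrixP/(_ i 0); rewrite !mxE => ->.
rewrite summxE horner_sum; apply: eq_bigr => j _.
by rewrite hornerZ mxE mulrC.
Qed.

Lemma is_derive_peval i (x : R) : 0 <= x <= 1 ->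
  is_derive x 1 (fun t => peval u (t * h) i 0) (h * (slope h u i).[x]).
Proof.
move=> x01; have -> : (fun t => peval u (t * h) i 0) = horner (u i 0 \Po (h *: 'X)).
  by apply/funext => t; rewrite mxE horner_comp hornerZ hornerX mulrC.
apply: trigger_derive.
rewrite deriv_comp derivZ derivX hornerM horner_comp !hornerZ hornerX hornerC mulr1.
by rewrite [h * x]mulrC slopeE// mulrC.
Qed.

(** The difference [K] has derivative 0, so the mean value bound with constant 0 makes it
    constant. *)
Lemma peval_slope i x : 0 <= x <= 1 ->
  peval u (x * h) i 0 = y0 i 0 + h * (prim (slope h u i)).[x].
Proof.
case: Hu => _ u0 _ /andP[x0 x1].
pose K t := peval u (t * h) i 0 - h * (prim (slope h u i)).[t].
have dK t : 0 < t < x -> is_derive t 1 K ((fun _ => 0) t).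
  move=> /andP[t0 tx].
  have t01 : 0 <= t <= 1 by rewrite !ltW// (lt_le_trans tx).
  have := is_derive_peval i t01.
  have -> : K = (fun t => peval u (t * h) i 0) - horner (h *: prim (slope h u i)).
    by apply/funext => v; rewrite /K !fctE hornerZ.
  move=> D1; apply: trigger_derive.
  by rewrite derivZ deriv_prim hornerZ subrr.
have cK : {within `[0, x], continuous K}.
  apply: continuous_subspaceT => t.
  have -> : K = horner (u i 0 \Po (h *: 'X) - h *: prim (slope h u i)).
    apply/funext => v.
    by rewrite /K mxE hornerD hornerN horner_comp !hornerZ hornerX mulrC.
  exact: continuous_horner.
have := mvt_le x0 dK cK (B := 0).
rewrite mul0r normr0 => /(_ (fun _ _ => lexx _)).
rewrite normr_le0 subr_eq0 => /eqP; rewrite /K mul0r u0 prim_horner0 mulr0 subr0 => <-.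
by rewrite subrK.
Qed.

(** Testing the projection identity with the slope components replaces F by the slope; a skew matrix
    is then contracted with the symmetric Gram matrix [D]. *)
Lemma energy_quadrature (S : 'M[R]_n) : S^T = - S ->
  Q (fun x => \sum_i (S *m F (peval u (x * h))) i 0 * (slope h u i).[x]) = 0.
Proof.
move=> skew; set q := Q _.
pose D i l := Q (fun x => (slope h u i).[x] * (slope h u l).[x]).
have DC i l : D i l = D l i by apply: eq_bigr => j _; rewrite mulrC [X in _ = _ * X]mulrC mulrC.
have -> : q = \sum_i \sum_l S i l * D i l.
  rewrite /q quadrature_sum; apply: eq_bigr => i _.
  under [RHS]eq_bigr => l _ do rewrite /D slope_projection ?size_slope// -quadratureZ.
  rewrite -quadrature_sum; apply: eq_bigr => j _; congr (_ * _).
  by rewrite mxE mulr_suml; apply: eq_bigr => l _; rewrite mulrAC mulrA.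
set X := \sum_i _.
have XN : X = - X.
  rewrite {1}/X exchange_big /= /X -sumrN; apply: eq_bigr => i _.
  rewrite -sumrN; apply: eq_bigr => l _.
  have := congr1 (fun A : 'M[R]_n => A i l) skew; rewrite !mxE => ->.
  by rewrite mulNr DC.
by lra.
Qed.

End Hbvm.
End SingleStep.

(** * Regularity of the numerical solution *)

Section Tame.
Variables (R : realType) (n N : nat) (y0 : 'cV[R]_n).

(* [y0] is the initial value: the second clause replaces the smoothness of order
   N of [phi] at [y0]. *)
Definition tame (phi : 'cV[R]_n -> R) :=
  (forall M : R, exists C, forall x : 'cV[R]_n, (forall j, `|x j 0| <= M) -> `|phi x| <= C) /\
  (forall (z : R -> R -> 'cV[R]_n) m, (m <= N)%N ->
    (forall j, scaled m (fun h t => z h t j 0)) ->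
    (forall j, unifO 1 (fun h t => z h t j 0 - y0 j 0)) ->
    scaled m (fun h t => phi (z h t))).

(** The functions [A j] act as partial derivatives with a quadratic remainder on bounded sets. In
    this form closure under sums and products is pure algebra. *)
Definition linearisable phi := tame phi /\
  exists A : 'I_n -> 'cV[R]_n -> R, (forall j, tame (A j)) /\
    forall M : R, exists C, forall x z : 'cV[R]_n,
      (forall j, `|x j 0| <= M) -> (forall j, `|z j 0| <= M) ->
      `|phi x - phi z - \sum_j A j x * (x j 0 - z j 0)| <=
        C * \sum_j (x j 0 - z j 0) ^+ 2.

End Tame.

Section Families.
Variables (R : realType).

Lemma unifO_poly (q : {poly R}) : unifO 0 (fun _ t => q.[t]).
Proof.
have [C qC] := continuous_bounded 1 (@continuous_horner _ q).
exists C; apply: nearW => h t /andP[t0 t1]; rewrite expr0 mulr1 qC//.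
by rewrite ger0_norm.
Qed.

Lemma unifO_horner n (a : R -> R) (q : {poly R}) :
  unifO n (fun h _ => a h) -> unifO n (fun h t => a h * q.[t]).
Proof.
by move=> an; rewrite -[n]addn0; apply: unifOM => //; exact: unifO_poly.
Qed.

(** All coefficients of [q] have index i <= j, and h^j <= h^i for h <= 1. *)
Lemma graded_scale j (a : R -> R) (q : {poly R}) : (size q <= j.+1)%N ->
  unifO j (fun h _ => a h) -> graded 0 (fun h => a h *: q).
Proof.
move=> qj /unifO_pos[C C0 aC].
exists (C * \sum_(i < j.+1) `|q`_i|), j.+1.
apply: filterS aC => h [/andP[h0 h1] aC]; split=> [|i].
  by rewrite (leq_trans (size_scale_leq _ _)).
have S0 : 0 <= \sum_(i < j.+1) `|q`_i| by apply: sumr_ge0.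
rewrite coefZ maxn0; have [ij|ji] := ltnP i j.+1; last first.
  rewrite nth_default ?(leq_trans qj)// mulr0 normr0.
  by rewrite !mulr_ge0// exprn_ge0// ltW.
rewrite normrM mulrAC ler_pM//.
  rewrite (le_trans (aC 0 _)) ?lexx ?ler01// ler_wpM2l//.
  by rewrite ler_wiXn2l// ltW.
by rewrite (bigD1 (Ordinal ij))//= lerDl sumr_ge0.
Qed.

End Families.

Section Bootstrap.
Variables (R : realType) (P : nat -> {poly R}) (k s : nat) (c b : 'I_k -> R).
Hypotheses (HP : legendre_family P) (Hg : gauss_legendre P c b) (sk : (s <= k)%N).
Variables (n : nat) (F : 'cV[R]_n -> 'cV[R]_n) (y0 : 'cV[R]_n).
Hypothesis Ftame : forall i, tame (2 * k) y0 (fun y => F y i 0).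
Variable U : R -> 'cV[{poly R}]_n.
Hypothesis HU : hbvm_method P s c b F y0 U.
Local Notation Q := (quadrature c b).

Definition stage (h t : R) : 'cV[R]_n := peval (U h) (t * h).
Local Notation sl h i := (slope P s c b F h (U h) i).

Lemma stage_at0 h : stage h 0 = peval (U h) 0.
Proof. by rewrite /stage mul0r. Qed.

Lemma stage_at1 h : stage h 1 = peval (U h) h.
Proof. by rewrite /stage mul1r. Qed.

Lemma unifO_quadrature m w : unifO m w -> unifO m (fun h _ => Q (w h)).
Proof.
move=> [C wC]; exists ((\sum_i `|b i|) * C); apply: filterS wC => h wC t _.
rewrite (le_trans (ler_norm_sum _ _ _))// -mulrA mulr_suml ler_sum// => i _.
by rewrite normrM ler_wpM2l// wC// (node_itv HP Hg).
Qed.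

Lemma near_hbvm : \forall h \near 0^'+, 0 < h /\ hbvm P s c b F y0 h (U h).
Proof.
have [H _] := HU; apply: filterS2 (near_le1 R) H => h /andP[h0 _] H.
by split.
Qed.

Lemma unifO_stage i : unifO 0 (fun h t => stage h t i 0).
Proof.
have [_ [M UM]] := HU; exists M; apply: filterS UM => h UM t /UM; rewrite mulr1.
apply: le_trans; rewrite [leRHS]/Num.Def.normr /= mx_normrE.
exact: (le_bigmax _ (fun ij => `|stage h t ij.1 ij.2|) (i, 0)).
Qed.

Lemma unifO_tame phi : tame (2 * k) y0 phi -> unifO 0 (fun h t => phi (stage h t)).
Proof.
move=> [phiM _]; have [_ [M UM]] := HU; have [C phiC] := phiM M.
exists C; apply: filterS UM => h UM t /UM tM; rewrite mulr1 phiC// => i.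
apply: le_trans tM; rewrite [leRHS]/Num.Def.normr /= mx_normrE.
exact: (le_bigmax _ (fun ij => `|stage h t ij.1 ij.2|) (i, 0)).
Qed.

(** The invariant of the bootstrap: with each [m] one more power of h is gained, until the j-th
    coefficient reaches O(h^j). *)
Definition gamma_decay m := forall j i, (j < s)%N ->
  unifO (minn j m) (fun h _ => hbvm_gamma P c b F h (U h) j i 0).

Lemma gamma_decay0 : gamma_decay 0.
Proof.
move=> j i _; rewrite minn0.
under [X in unifO 0 X]eq_fun => h do under eq_fun => t do rewrite hbvm_gammaE.
apply: unifO_quadrature.
exact: (unifOM (unifO_poly (P j)) (unifO_tame (Ftame i))).
Qed.

(** The stage is the initial value plus h times the sum of the coefficients times the primitives of
    the Legendre polynomials. *)
Lemma stageE m : gamma_decay m -> forall i,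
  scaled m.+1 (fun h t => stage h t i 0) /\
  unifO 1 (fun h t => stage h t i 0 - y0 i 0).
Proof.
move=> gm i.
pose a j h := h * hbvm_gamma P c b F h (U h) j i 0.
have aO j : (j < s)%N -> unifO (minn j m).+1 (fun h _ => a j h).
  by move=> js; have := unifOM (@unifO_pow R 1) (gm j i js).
have zE : \forall h \near 0^'+, forall t, 0 <= t <= 1 ->
    stage h t i 0 = y0 i 0 + \sum_(j < s) a j h * (prim (P j)).[t].
  apply: filterS near_hbvm => h [h0 Hh] t t01.
  rewrite (peval_slope Hh)// /slope linear_sum horner_sum mulr_sumr.
  by congr (_ + _); apply: eq_bigr => j _; rewrite linearZ hornerZ mulrA.
split.
  apply: eq_scaled zE _; apply: scaledD; first exact: scaled_cst.
  apply: scaled_sum => j; have := aO j (ltn_ord j).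
  (* For j <= m the factor is O(h^(j+1)) and the primitive has degree at most j + 1, a legitimate
     term of the expansion; for j > m the whole term is O(h^(m+1)) and goes to the remainder. *)
  have [jm|mj] := leqP j m.
    move=> aj.
    have : graded 0 (fun h => a j h *: prim (P j)).
      by apply: graded_scale aj; apply: size_prim; rewrite size_legendre.
    move=> /(graded_scaled m.+1); apply: eq_scaled.
    by apply: nearW => h t _; rewrite hornerZ.
  by move=> aj; apply: unifO_scaled; exact: unifO_horner.
apply: (@eq_unifO _ _ _ (fun h t => \sum_(j < s) a j h * (prim (P j)).[t])).
  by apply: filterS zE => h zE t /zE ->; rewrite addrC addKr.
apply: unifO_sum => j; apply: unifO_horner.
exact: unifO_le (aO j (ltn_ord j)).
Qed.

(** Expand F along the stage to order min(j, m + 1). The polynomial part has degree below j, hence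
    is orthogonal to [P j], and only the remainder contributes. *)
Lemma gamma_decayS m : (m.+1 <= 2 * k)%N -> gamma_decay m -> gamma_decay m.+1.
Proof.
move=> mk gm j i js.
have zm := stageE gm.
have : scaled m.+1 (fun h t => F (stage h t) i 0).
  by apply: (Ftame i).2 => // l; [exact: (zm l).1|exact: (zm l).2].
move=> /(scaled_le (geq_minr j m.+1)) /scaled_trunc[p [_ sp Fp]].
under [X in unifO _ X]eq_fun => h do under eq_fun => t do rewrite hbvm_gammaE.
have := unifO_quadrature (unifOM (unifO_poly (P j)) Fp); rewrite add0n.
apply: eq_unifO; apply: nearW => h _ _.
transitivity (Q (fun x => (P j).[x] * (F (stage h x) i 0 - (p h).[x])) +
              Q (fun x => (P j).[x] * (p h).[x])).
  by rewrite -quadratureD; apply: eq_bigr => l _; congr (_ * _); rewrite -mulrDr subrK.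
have spj : (size (p h) <= j)%N by rewrite (leq_trans (sp h))// geq_minl.
rewrite [X in _ + X](gauss_exactM HP Hg) ?(legendre_orthogonal HP)// ?addr0//.
  by rewrite size_legendre// (leq_trans js).
by rewrite (leq_trans spj)// ltnW// (leq_trans js).
Qed.

Lemma gamma_decayT m : (m <= 2 * k)%N -> gamma_decay m.
Proof.
elim: m => [|m IHm] mk; first exact: gamma_decay0.
by apply: gamma_decayS => //; apply: IHm; exact: ltnW.
Qed.

Lemma stage_scaled i : scaled (2 * k) (fun h t => stage h t i 0).
Proof.
by apply: scaled_le (stageE (gamma_decayT (leqnn _)) i).1; exact: leqnSn.
Qed.

Lemma stage_start i : unifO 1 (fun h t => stage h t i 0 - y0 i 0).
Proof. exact: (stageE (gamma_decayT (leq0n _)) i).2. Qed.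

Lemma tame_stage phi : tame (2 * k) y0 phi ->
  scaled (2 * k) (fun h t => phi (stage h t)).
Proof.
by move=> [_ phiS]; apply: phiS => // j; [exact: stage_scaled|exact: stage_start].
Qed.

Lemma slope_graded i : graded 0 (fun h => sl h i).
Proof.
apply: graded_sum => j; apply: (graded_scale (j := j)); first by rewrite size_legendre.
have js := leq_trans (ltn_ord j) sk.
have jk : (j <= 2 * k)%N by rewrite (leq_trans (ltnW js))// leq_pmull.
by have := gamma_decayT jk i (ltn_ord j); rewrite minnn.
Qed.

Definition defect i h t := (sl h i).[t] - F (stage h t) i 0.

Lemma defectE i h t : defect i h t = (sl h i).[t] - F (stage h t) i 0.
Proof. by []. Qed.

Lemma defect_scaled i : scaled (2 * k) (defect i).
Proof. by apply: scaledB; [exact/graded_scaled/slope_graded|exact: (tame_stage (Ftame i))]. Qed.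

Lemma defect_orth i h (q : {poly R}) : (size q <= s)%N ->
  Q (fun x => q.[x] * defect i h x) = 0.
Proof.
move=> qs; rewrite /defect.
transitivity (Q (fun x => q.[x] * (sl h i).[x]) - Q (fun x => q.[x] * F (stage h x) i 0)).
  by rewrite -quadratureB; apply: eq_bigr => j _; rewrite mulrBr.
by rewrite slope_projection// subrr.
Qed.

(** Split the defect into a polynomial [p] of degree below s and a remainder [e] of order s.
    Orthogonality of the defect says that the Legendre coefficients of [p] are the opposites of
    Q(P_j e), so [p] is O(h^s) too. *)
Lemma defect_unifO i : unifO s (defect i).
Proof.
have s2k : (s <= 2 * k)%N by rewrite (leq_trans sk)// leq_pmull.
have /scaled_trunc[p [_ sp rp]] := scaled_le s2k (defect_scaled i).
pose e h t := defect i h t - (p h).[t].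
have : unifO s (fun h t => \sum_(j < s) Q (fun x => (P j).[x] * e h x) * (P j).[t]).
  apply: unifO_sum => j; apply: unifO_horner; apply: unifO_quadrature.
  exact: (unifOM (unifO_poly (P j)) rp).
move=> eO; apply: eq_unifO (unifOB rp eO); apply: nearW => h t _.
rewrite {1}(legendre_expansion HP (sp h)) horner_sum -addrA -opprD -big_split/=.
rewrite big1 ?subr0// => j _; rewrite hornerZ -mulrDl.
rewrite -(gauss_exactM HP Hg) ?size_legendre ?(leq_trans (ltn_ord j))// ?(leq_trans (sp h))//.
rewrite -quadratureD -[RHS](mul0r (P j).[t]); congr (_ * _).
have js : (size (P j) <= s)%N by rewrite size_legendre.
rewrite -[RHS](defect_orth i h js); apply: eq_bigr => l _; congr (_ * _).
by rewrite -mulrDr /e addrC subrK.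
Qed.

End Bootstrap.

(** * The energy error *)

Section Orders.
Variables (R : realType) (P : nat -> {poly R}) (k s : nat) (c b : 'I_k -> R).
Hypotheses (HP : legendre_family P) (Hg : gauss_legendre P c b) (sk : (s <= k)%N).
Variables (n : nat) (F : 'cV[R]_n -> 'cV[R]_n) (y0 : 'cV[R]_n).
Hypothesis Ftame : forall i, tame (2 * k) y0 (fun y => F y i 0).
Variable U : R -> 'cV[{poly R}]_n.
Hypothesis HU : hbvm_method P s c b F y0 U.
Local Notation Q := (quadrature c b).
Local Notation sl h i := (slope P s c b F h (U h) i).
Local Notation stage := (stage U).
Local Notation defect := (defect P s c b F U).

(** [w] is not known to be integrable, so its truncation [tau] is integrated instead; the quadrature
    is exact on [tau] because m <= 2k. *)
Lemma quadrature_error m w : (m <= 2 * k)%N -> scaled m w ->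
  exists tau : R -> {poly R}, unifO m (fun h t => w h t - (tau h).[t]) /\
    unifO m (fun h _ => Int (tau h) - Q (w h)).
Proof.
move=> mk /scaled_trunc[tau [_ stau wtau]]; exists tau; split=> //.
apply: eq_unifO (unifON (unifO_quadrature HP Hg wtau)); apply: nearW => h _ _.
rewrite -(gauss_exact HP Hg); last first.
  by rewrite (leq_trans (stau h))// (leq_trans mk)// mul2n addnn.
by rewrite quadratureB opprB.
Qed.

(** [r] is an approximate primitive of the defect weighted by [p]. Its increment is small because
    the quadrature of the weighted defect is exactly 0 and the quadrature error is O(h^(2s)). *)
Lemma defect_weak i (p : R -> {poly R}) : graded 0 p -> (forall h, (size (p h) <= s)%N) ->
  exists r : R -> {poly R},
    unifO (2 * s) (fun h t => (r h)^`().[t] - (p h).[t] * defect i h t) /\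
    unifO (2 * s) (fun h _ => (r h).[1] - (r h).[0]).
Proof.
move=> p0 sp; have s2k : (2 * s <= 2 * k)%N by rewrite leq_mul2l.
have := scaled_le s2k (scaledM (graded_scaled _ p0) (defect_scaled HP Hg sk Ftame HU i)).
move=> /(quadrature_error s2k)[tau [tauO IO]]; exists (fun h => prim (tau h)); split.
  by apply: eq_unifO (unifON tauO); apply: nearW => h t _; rewrite deriv_prim opprB.
apply: eq_unifO IO; apply: nearW => h _ _.
by rewrite (defect_orth HP Hg sk)// prim_horner0.
Qed.

(** The second hypothesis is the chain rule with gradient S F. Subtracting h times the primitive of
    [tau] from the energy leaves a function with derivative O(h^(2k+1)), and the integral of [tau]
    is O(h^(2k)) since Q(D) = 0. *)
Lemma energy_order (H : 'cV[R]_n -> R) (S : 'M[R]_n) : S^T = - S ->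
  (forall (z : R -> 'cV[R]_n) (dz : 'cV[R]_n) (t : R),
    (forall i, is_derive t 1 (fun t => z t i 0) (dz i 0)) ->
    is_derive t 1 (fun t => H (z t)) (\sum_i (S *m F (z t)) i 0 * dz i 0)) ->
  unifO (2 * k + 1) (fun h _ => H (peval (U h) h) - H y0).
Proof.
move=> skew dH.
pose D h t := \sum_i (S *m F (stage h t)) i 0 * (sl h i).[t].
have DS : scaled (2 * k) D.
  apply: scaled_sum => i; apply: scaledM.
    apply: (@eq_scaled _ _ _ (fun h t => \sum_l S i l * F (stage h t) l 0)).
      by apply: nearW => h t _; rewrite mxE.
    by apply: scaled_sum => l; apply: scaledZ; exact: (tame_stage HP Hg sk Ftame HU (Ftame l)).
  by apply: graded_scaled; exact: (slope_graded HP Hg sk Ftame HU).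
have [tau [tauO IO]] := quadrature_error (leqnn _) DS.
have QD h : Q (D h) = 0 by exact: (energy_quadrature HP Hg sk F h (U h) skew).
pose K h t := H (stage h t) - h * (prim (tau h)).[t].
pose K' h t := h * (D h t - (tau h).[t]).
have KO : unifO (2 * k + 1) K'.
  rewrite addnC; exact: (unifOM (@unifO_pow R 1) tauO).
have CK : \forall h \near 0^'+, C1_01 (K h) (K' h).
  apply: filterS (near_hbvm HU) => h [_ Hh].
  have dK (t : R) : 0 <= t <= 1 -> is_derive t 1 (K h) (K' h t).
    move=> t01.
    have -> : K' h t = \sum_i (S *m F (stage h t)) i 0 * (h *: \col_i (sl h i).[t]) i 0 -
       h * (prim (tau h))^`().[t].
      rewrite /K' deriv_prim mulrBr mulr_sumr; congr (_ - _).
      apply: eq_bigr => i _; have -> : (h *: \col_i (sl h i).[t]) i 0 = h * (sl h i).[t].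
        by rewrite !mxE.
      by rewrite mulrCA.
    apply: is_deriveB.
      apply: dH => i; rewrite mxE mxE; exact: (is_derive_peval Hh).
  split=> [t /andP[t0 t1]|]; first by apply: dK; rewrite !ltW.
  apply: derivable_within_continuous => t; rewrite in_itv/= => t01.
  exact: (@ex_derive _ _ _ _ _ _ _ (dK t t01)).
have i01 : 0 <= (1 : R) <= 1 by rewrite lexx ler01.
have hIO := unifOM (@unifO_pow R 1) IO; rewrite addnC in hIO.
have := unifOD (unifO_at i01 (unifO_mvt CK KO)) hIO; apply: eq_unifO.
apply: filterS (near_hbvm HU) => h [_ [_ z0 _]] _ _; rewrite QD.
by rewrite /K stage_at0 stage_at1 z0 prim_horner0 /Int subr0 mulr0 subr0 expr1 addrAC subrK.
Qed.

End Orders.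

(** * The order of convergence *)

Section Solution.
Variables (R : realType) (n : nat) (F : 'cV[R]_n -> 'cV[R]_n) (T : R) (y : R -> 'cV[R]_n).
Hypotheses (T0 : 0 < T) (y0 : y t @[t --> 0^'+] --> y 0).
Hypothesis dy : forall t : R, 0 < t < T -> is_derive t 1 y (F (y t)).

Lemma solution_derive i (t : R) : 0 < t < T ->
  is_derive t 1 (fun t => y t i 0) (F (y t) i 0).
Proof.
move=> /dy Dy; have dyt := @ex_derive _ _ _ _ _ _ _ Dy.
apply: DeriveDef; first by move/derivable_mxP : dyt; apply.
by rewrite -(@derive_val _ _ _ _ _ _ _ Dy) derive_mx// mxE.
Qed.

Lemma solution_right i (e : R) : 0 < e ->
  exists2 d : R, 0 < d & forall x, 0 <= x < d -> `|y x i 0 - y 0 i 0| <= e.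
Proof.
move=> e0.
have : (y t i 0) @[t --> (0 : R)^'+] --> y 0 i 0.
  exact: (cvg_comp _ _ y0 (@coord_continuous _ _ _ i 0 (y 0))).
move=> /cvgrPdist_le/(_ e e0)[d /= d0 yd]; exists d => // x /andP[x0 xd].
move: x0; rewrite le_eqVlt => /predU1P[<-|x0]; first by rewrite subrr normr0 ltW.
by rewrite distrC yd//= sub0r normrN gtr0_norm.
Qed.

Lemma solution_C1_01 i (h : R) : 0 < h < T ->
  C1_01 (fun t => y (t * h) i 0) (fun t => h * F (y (t * h)) i 0).
Proof.
move=> /andP[h0 hT].
have D (t : R) : 0 < t <= 1 -> is_derive t 1 (fun t => y (t * h) i 0) (h * F (y (t * h)) i 0).
  move=> /andP[t0 t1]; rewrite mulrC.
  apply: (is_derive_comp_fun (f := fun t => y t i 0) (g := fun t => t * h)).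
    apply: solution_derive; rewrite mulr_gt0//= (le_lt_trans _ hT)//.
    by rewrite ler_piMl// ltW.
  have := is_deriveZ_fun h (is_derive_id t (1 : R)).
  by rewrite mulr1; under eq_fun do rewrite mulrC.
split=> [t /andP[t0 t1]|]; first by apply: D; rewrite t0 ltW.
apply/continuous_within_itvP => //; split.
- move=> t; rewrite in_itv/= => /andP[t0 t1].
  apply/differentiable_continuous/derivable1_diffP.
  by apply: (@ex_derive _ _ _ _ _ _ _ (D t _)); rewrite t0 ltW.
(* At the left end only the right continuity of [y] is available. *)
- apply/cvgrPdist_le => e e0; have [d d0 yd] := solution_right i e0.
  near=> t; rewrite mul0r distrC yd//; apply/andP; split.
    by rewrite mulr_ge0// ltW.
  rewrite -ltr_pdivlMr//; near: t; apply: nbhs_right_lt; exact: divr_gt0.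
- apply: cvg_at_left_filter.
  apply/differentiable_continuous/derivable1_diffP.
  by apply: (@ex_derive _ _ _ _ _ _ _ (D 1 _)); rewrite ltr01 lexx.
Unshelve. all: end_near. Qed.

Lemma solution_bounded i : unifO 0 (fun h t => y (t * h) i 0).
Proof.
have [d d0 yd] := solution_right i (@ltr01 R).
exists (1 + `|y 0 i 0|).
have hd : \forall h \near (0 : R)^'+, h < d by exact: nbhs_right_lt.
apply: filterS2 (near_le1 R) hd => h /andP[h0 _] hd t /andP[t0 t1].
rewrite expr0 mulr1 -[y (t * h) i 0](subrK (y 0 i 0)).
rewrite (le_trans (ler_normD _ _))// lerD2r yd//.
rewrite mulr_ge0 ?(ltW h0)//= (le_lt_trans _ hd)//.
by rewrite ler_piMl// ltW.
Qed.

End Solution.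

(** * Weighted estimates of the error *)

Section Error.
Variables (R : realType) (P : nat -> {poly R}) (k s : nat) (c b : 'I_k -> R).
Hypotheses (HP : legendre_family P) (Hg : gauss_legendre P c b).
Hypotheses (s1 : (1 <= s)%N) (sk : (s <= k)%N).
Variables (n : nat) (F : 'cV[R]_n -> 'cV[R]_n) (y0 : 'cV[R]_n).
Hypothesis Flin : forall i, linearisable (2 * k) y0 (fun y => F y i 0).
Variable U : R -> 'cV[{poly R}]_n.
Hypothesis HU : hbvm_method P s c b F y0 U.
Variables (T : R) (y : R -> 'cV[R]_n).
Hypotheses (T0 : 0 < T) (y00 : y 0 = y0) (yr : y t @[t --> 0^'+] --> y 0).
Hypothesis dy : forall t : R, 0 < t < T -> is_derive t 1 y (F (y t)).
Local Notation Q := (quadrature c b).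
Local Notation sl h i := (slope P s c b F h (U h) i).
Local Notation stage := (stage U).
Local Notation defect := (defect P s c b F U).

Let Ftame i : tame (2 * k) y0 (fun y => F y i 0) := (Flin i).1.

Definition err i h t := stage h t i 0 - y (t * h) i 0.
Definition err' i h t := h * ((sl h i).[t] - F (y (t * h)) i 0).

Lemma err_C1_01 : \forall h \near 0^'+, forall i, C1_01 (err i h) (err' i h).
Proof.
have hT : \forall h \near (0 : R)^'+, h < T by exact: nbhs_right_lt.
apply: filterS2 (near_hbvm HU) hT => h [h0 Hh] hT i.
have C1 : C1_01 (fun t => stage h t i 0) (fun t => h * (sl h i).[t]).
  have D (t : R) : 0 <= t <= 1 -> is_derive t 1 (fun t => stage h t i 0) (h * (sl h i).[t]).
    by move=> t01; exact: (is_derive_peval Hh).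
  split=> [t /andP[t0 t1]|]; first by apply: D; rewrite !ltW.
  apply: derivable_within_continuous => t; rewrite in_itv/= => t01.
  exact: (@ex_derive _ _ _ _ _ _ _ (D t t01)).
have C2 : C1_01 (fun t => y (t * h) i 0) (fun t => h * F (y (t * h)) i 0).
  by apply: (solution_C1_01 yr dy); rewrite h0.
have := C1_01B C1 C2; rewrite /err' /err.
by under [X in C1_01 _ X -> _]eq_fun do rewrite -mulrBr.
Qed.

Lemma err0 i : \forall h \near 0^'+, err i h 0 = 0.
Proof.
apply: filterS (near_hbvm HU) => h [_ [_ z0 _]].
by rewrite /err stage_at0 mul0r z0 y00 subrr.
Qed.

(** The derivatives are taken at the numerical stage, whose expansion in c h is known; of the exact
    solution only boundedness is used here. *)
Lemma linearised i : exists2 A : 'I_n -> R -> R -> R,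
  forall j, scaled (2 * k) (A j) &
  forall m, (forall j, unifO m (err j)) ->
    unifO (m + m) (fun h t => F (stage h t) i 0 - F (y (t * h)) i 0 -
      \sum_j A j h t * err j h t).
Proof.
have [_ [A [Atame AM]]] := Flin i.
exists (fun j h t => A j (stage h t)).
  by move=> j; exact: (tame_stage HP Hg sk Ftame HU (Atame j)).
move=> m em.
have [C1 C10 uC] := unifO_unif (unifO_stage HU).
have [C2 C20 yC] := unifO_unif (solution_bounded yr).
have [D AD] := AM (C1 + C2).
have sqO : unifO (m + m) (fun h t => D * \sum_j err j h t * err j h t).
  by apply: unifOZ; apply: unifO_sum => j; exact: unifOM.
have [E EC] := sqO; exists E.
apply: filterS3 uC yC EC => h uC yC EC t t01; rewrite (le_trans _ (EC t t01))//.
have -> : \sum_j err j h t * err j h t =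
    \sum_j (stage h t j 0 - y (t * h) j 0) ^+ 2.
  by apply: eq_bigr => j _; rewrite expr2.
apply: le_trans (ler_norm _).
apply: AD => j.
  by rewrite (le_trans (uC t t01 j))// expr0 mulr1 lerDl.
by rewrite (le_trans (yC t t01 j))// expr0 mulr1 lerDr.
Qed.

Lemma linearisedT : exists2 A : 'I_n -> 'I_n -> R -> R -> R,
  forall i j, scaled (2 * k) (A i j) &
  forall i m, (forall j, unifO m (err j)) ->
    unifO (m + m) (fun h t => F (stage h t) i 0 - F (y (t * h)) i 0 -
      \sum_j A i j h t * err j h t).
Proof.
have [A AO] := choice (fun i => let: ex_intro2 A p q := linearised i in
  ex_intro (fun A => (forall j, scaled (2 * k) (A j)) /\ forall m, (forall j, unifO m (err j)) ->
    unifO (m + m) (fun h t => F (stage h t) i 0 - F (y (t * h)) i 0 -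
      \sum_j A j h t * err j h t)) A (conj p q)).
by exists A => i; have [] := AO i.
Qed.

(** Takes the place of a Gronwall argument: if all errors are O(h^m), the error equation makes their
    derivatives O(h^(m+1)), and they start at 0. The gain stops when the defect O(h^s) dominates. *)
Lemma err_unifO m : (m <= s.+1)%N -> forall i, unifO m (err i).
Proof.
elim: m => [_|m IHm ms] i.
  by apply: unifOB; [exact: unifO_stage HU i|exact: solution_bounded].
have {}IHm := IHm (ltnW ms).
have [A AS Alin] := linearised i.
have e'O : unifO m.+1 (err' i).
  rewrite -[m.+1]add1n; apply: (unifOM (@unifO_pow R 1)) => /=.
  have rO : unifO m (defect i) by apply: unifO_le (defect_unifO HP Hg sk Ftame HU i).
  have lO := unifO_le (leq_addr m m) (Alin m IHm).
  have AO : unifO m (fun h t => \sum_j A j h t * err j h t).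
    by apply: unifO_sum => j; exact: (unifOM (scaled_unifO (AS j)) (IHm j)).
  apply: eq_unifO (unifOD rO (unifOD lO AO)); apply: nearW => h t _.
  by rewrite defectE subrK addrA subrK.
have Ci : \forall h \near 0^'+, C1_01 (err i h) (err' i h).
  by apply: filterS err_C1_01.
apply: eq_unifO (unifO_mvt Ci e'O); apply: filterS (err0 i) => h -> t _.
by rewrite subr0.
Qed.

(** [Z] is an approximate primitive of the weighted error, so the claim is that the weighted error
    has integral O(h^(2s)). The size [s.-1] leaves room for one integration, after which the weight
    is still a test polynomial orthogonal to the defect. *)
Definition weighted_estimate l := forall (w : 'I_n -> R -> {poly R}) (Z Z' : R -> R -> R),
  (forall j, graded l (w j)) -> (forall j h, (size (w j h) <= s.-1)%N) ->
  (\forall h \near 0^'+, C1_01 (Z h) (Z' h)) ->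
  unifO (2 * s) (fun h t => Z' h t - \sum_j (w j h).[t] * err j h t) ->
  unifO (2 * s) (fun h _ => Z h 1 - Z h 0).

Let i01 : 0 <= (1 : R) <= 1. Proof. by rewrite lexx ler01. Qed.

(** The weight is O(h^(s-1)) and the error O(h^(s+1)). *)
Lemma weighted_estimate_top : weighted_estimate s.-1.
Proof.
move=> w Z Z' wl ws CZ Z'O; apply: (unifO_at (f := fun h t => Z h t - Z h 0) i01).
apply: unifO_mvt CZ _.
have wO : unifO (2 * s) (fun h t => \sum_j (w j h).[t] * err j h t).
  apply: unifO_sum => j.
  have -> : (2 * s = s.-1 + s.+1)%N by rewrite mul2n -addnn addnS -addSn prednK.
  by apply: unifOM; [exact: graded_unifO|exact: err_unifO].
by apply: eq_unifO (unifOD Z'O wO); apply: nearW => h t _; rewrite subrK.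
Qed.

(** Integration raises the index by one and the factor h raises the order by one; the new constant
    term is governed by the integral of [w], which is O(h^l). *)
Lemma graded_prim0 l (w : R -> {poly R}) : graded l w ->
  graded l.+1 (fun h => h *: (prim (w h) - (Int (w h))%:P)).
Proof.
move=> wl; have /unifO_pos[D D0 ID] : unifO l (fun h _ => Int (w h)).
  have CP : \forall h \near (0 : R)^'+, C1_01 (horner (prim (w h))) (horner (w h)).
    by apply: nearW => h; have := C1_01_poly (prim (w h)); rewrite deriv_prim.
  apply: eq_unifO (unifO_at i01 (unifO_mvt CP (graded_unifO wl))).
  by apply: nearW => h _ _; rewrite prim_horner0 subr0.
move: wl => /graded_pos[C C0 [d wC]]; exists (C + D), d.+1.
apply: filterS2 wC ID => h [/andP[h0 h1] sw wC] [_ ID]; split.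
  rewrite (leq_trans (size_scale_leq _ _))// (leq_trans (size_polyD _ _))// size_polyN geq_max.
  by rewrite size_prim// (leq_trans (size_polyC_leq1 _)).
case=> [|i]; rewrite coefZ coefB coefC coef_prim normrM (gtr0_norm h0).
  rewrite invr0 mulr0 sub0r normrN max0n exprS mulrCA ler_pM2l//.
  by rewrite (le_trans (ID 0 _)) ?lexx ?ler01// ler_wpM2r ?exprn_ge0 ?lerDr// ltW.
rewrite subr0 maxnSS exprS mulrCA ler_pM2l// normrM.
apply: (@le_trans _ _ `|(w h)`_i|).
  by rewrite ler_piMr// ger0_norm ?invr_ge0// invf_le1// ler1n.
by rewrite (le_trans (wC i))// ler_wpM2r ?exprn_ge0 ?lerDl// ltW.
Qed.

(* Integration by parts against the primitive [V] of [h w] vanishing at 1 turns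
   the weight [w] into the weight [V A], which is smaller by one power of h. *)
Lemma weighted_estimateS l : weighted_estimate l.+1 -> weighted_estimate l.
Proof.
move=> IH w Z Z' wl ws CZ Z'O.
pose V j h : {poly R} := h *: (prim (w j h) - (Int (w j h))%:P).
have VG j : graded l.+1 (V j) by exact: graded_prim0.
have Vs j h : (size (V j h) <= s)%N.
  rewrite (leq_trans (size_scale_leq _ _))// (leq_trans (size_polyD _ _))// size_polyN geq_max.
  by rewrite -(prednK s1) size_prim// (leq_trans (size_polyC_leq1 _)).
have V' j h : (V j h)^`() = h *: w j h.
  by rewrite derivZ derivB deriv_prim derivC subr0.
have V1 j h : (V j h).[1] = 0.
  by rewrite hornerZ hornerD hornerN hornerC subrr mulr0.
have [r rO] := choice (fun j =>
  defect_weak HP Hg sk Ftame HU j (graded_le (leq0n _) (VG j)) (Vs j)).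
have [A AS Alin] := linearisedT.
have AP (ij : 'I_n * 'I_n) : exists p : R -> {poly R},
    [/\ graded 0 p, forall h, (size (p h) <= s.-1)%N &
     unifO s.-1 (fun h t => A ij.1 ij.2 h t - (p h).[t])].
  apply: scaled_trunc; apply: scaled_le (AS ij.1 ij.2).
  by rewrite (leq_trans (leq_pred s))// (leq_trans sk)// leq_pmull.
have [a aO] := choice AP.
(* Truncation restores the size bound on weights. Its cost O(h^(s-1)), like that of replacing [A] by
   [a], is harmless against an error O(h^(s+1)). *)
pose w2 j h := take_poly s.-1 (\sum_i V i h * a (i, j) h).
have Va j : graded l.+1 (fun h => \sum_i V i h * a (i, j) h).
  by apply: graded_sum => i; apply: gradedM => //; have [] := aO (i, j).
have w2G j : graded l.+1 (w2 j) by exact: graded_take.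
have w2s j h : (size (w2 j h) <= s.-1)%N by exact: size_take_poly.
have w2O j : unifO s.-1 (fun h t => \sum_i (V i h).[t] * A i j h t - (w2 j h).[t]).
  have VA : unifO s.-1 (fun h t => \sum_i (V i h).[t] * (A i j h t - (a (i, j) h).[t])).
    apply: unifO_sum => i; rewrite -[s.-1]add0n; apply: unifOM.
      by apply: graded_unifO; exact: (graded_le (leq0n _) (VG i)).
    by have [] := aO (i, j).
  apply: eq_unifO (unifOD VA (graded_trunc s.-1 (Va j))); apply: nearW => h t _.
  rewrite -/(w2 j h) addrA; congr (_ - _).
  rewrite horner_sum -big_split; apply: eq_bigr => i _ /=.
  by rewrite hornerM mulrBr subrK.
pose lin i h t := F (stage h t) i 0 - F (y (t * h)) i 0 - \sum_j A i j h t * err j h t.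
have linO i : unifO (2 * s) (lin i).
  by apply: unifO_le (Alin i _ (err_unifO (leqnn _))); rewrite mul2n -addnn leq_add.
(* Differentiating the first term gives the sum of w e, V r and V A e up to O(h^(2s)), with r the
   defect. Subtracting [Z] removes the first sum and subtracting the [r j] removes the second, which
   leaves the weight V A. *)
pose Z2 h t := h^-1 * (\sum_j (V j h).[t] * err j h t) - Z h t - \sum_j (r j h).[t].
pose Z2' h t := h^-1 * (\sum_j ((V j h)^`().[t] * err j h t + (V j h).[t] * err' j h t))
   - Z' h t - \sum_j (r j h)^`().[t].
have CZ2 : \forall h \near 0^'+, C1_01 (Z2 h) (Z2' h).
  apply: filterS2 CZ err_C1_01 => h CZ Ce.
  apply: C1_01B; last by apply: C1_01_sum => j; exact: C1_01_poly.
  apply: C1_01B => //; apply: C1_01Z; apply: C1_01_sum => j.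
  by apply: C1_01M => //; exact: C1_01_poly.
have Z2O : unifO (2 * s) (fun h t => Z2' h t - \sum_j (w2 j h).[t] * err j h t).
  have O1 : unifO (2 * s) (fun h t => \sum_j ((r j h)^`().[t] - (V j h).[t] * defect j h t)).
    by apply: unifO_sum => j; have [] := rO j.
  have O2 : unifO (2 * s) (fun h t => \sum_j (V j h).[t] * lin j h t).
    apply: unifO_sum => j; rewrite -[(2 * s)%N]add0n; apply: unifOM => //.
    by apply: graded_unifO; exact: (graded_le (leq0n _) (VG j)).
  have O3 : unifO (2 * s) (fun h t =>
      \sum_j (\sum_i (V i h).[t] * A i j h t - (w2 j h).[t]) * err j h t).
    apply: unifO_sum => j.
    have -> : (2 * s = s.-1 + s.+1)%N by rewrite mul2n -addnn addnS -addSn prednK.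
    by apply: unifOM; [exact: w2O|exact: err_unifO].
  apply: eq_unifO (unifOB (unifOD O2 O3) (unifOD Z'O O1)).
  apply: filterS (near_le1 R) => h /andP[h0 _] t _.
  have E1 : Z2' h t = \sum_j (w j h).[t] * err j h t +
      \sum_j (V j h).[t] * (defect j h t + lin j h t) +
      \sum_j (\sum_i (V i h).[t] * A i j h t) * err j h t -
      Z' h t - \sum_j (r j h)^`().[t].
    rewrite /Z2' mulr_sumr; congr (_ - _ - _).
    have -> : \sum_j (\sum_i (V i h).[t] * A i j h t) * err j h t =
        \sum_i (V i h).[t] * \sum_j A i j h t * err j h t.
      under eq_bigr do rewrite mulr_suml; rewrite exchange_big /=.
      by apply: eq_bigr => i _; rewrite mulr_sumr; apply: eq_bigr => j _; rewrite mulrA.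
    rewrite -!big_split; apply: eq_bigr => j _ /=.
    rewrite V' hornerZ /err' /lin defectE.
    by field; rewrite gt_eqF.
  rewrite E1.
  have -> : \sum_j (V j h).[t] * (defect j h t + lin j h t) =
     \sum_j (V j h).[t] * defect j h t + \sum_j (V j h).[t] * lin j h t.
    by rewrite -big_split; apply: eq_bigr => j _; rewrite mulrDr.
  rewrite [X in _ = _ + _ - (_ + X)]sumrB.
  have -> : \sum_j (\sum_i (V i h).[t] * A i j h t - (w2 j h).[t]) * err j h t =
     \sum_j (\sum_i (V i h).[t] * A i j h t) * err j h t -
     \sum_j (w2 j h).[t] * err j h t.
    by rewrite -sumrB; apply: eq_bigr => j _; rewrite mulrBl.
  ring.
have rO1 : unifO (2 * s) (fun h _ => \sum_j ((r j h).[1] - (r j h).[0])).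
  by apply: unifO_sum => j; have [] := rO j.
have e0 : \forall h \near 0^'+, forall j, err j h 0 = 0.
  by apply: filter_forall => j; exact: err0.
(* The boundary terms vanish because V is 0 at 1 and the error is 0 at 0. *)
apply: eq_unifO (unifON (unifOD (IH _ _ _ w2G w2s CZ2 Z2O) rO1)).
apply: filterS e0 => h e0 _ _; rewrite /Z2 sumrB.
rewrite [X in _ * X - _ - _]big1 => [|j _]; last by rewrite V1 mul0r.
rewrite [X in _ - (_ * X - _ - _)]big1 => [|j _]; last by rewrite e0 mulr0.
ring.
Qed.

Lemma weighted_estimate0 : weighted_estimate 0.
Proof.
have : forall m l, (l + m)%N = s.-1 -> weighted_estimate l.
  elim=> [|m IHm] l lm; first by rewrite -[l]addn0 lm; exact: weighted_estimate_top.
  by apply: weighted_estimateS; apply: IHm; rewrite addSnnS.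
by apply.
Qed.

(** The error equation is integrated over the step: the defect is handled with the weight 1, the
    term A e by [weighted_estimate0], and the factor h supplies the last power. *)
Lemma error_order i : unifO (2 * s + 1) (fun h _ => peval (U h) h i 0 - y h i 0).
Proof.
have G1 : graded 0 (fun _ => (1 : {poly R})).
  by have := gradedC (@unifO_cst R 1).
have [r [rO rO1]] := defect_weak HP Hg sk Ftame HU i G1 (fun _ => leq_trans (size_polyC_leq1 _) s1).
have [A AS Alin] := linearisedT.
have AP j : exists p : R -> {poly R},
    [/\ graded 0 p, forall h, (size (p h) <= s.-1)%N &
     unifO s.-1 (fun h t => A i j h t - (p h).[t])].
  apply: scaled_trunc; apply: scaled_le (AS i j).
  by rewrite (leq_trans (leq_pred s))// (leq_trans sk)// leq_pmull.
have [a aO] := choice AP.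
pose Z h t := h^-1 * err i h t - (r h).[t].
pose Z' h t := h^-1 * err' i h t - (r h)^`().[t].
have CZ : \forall h \near 0^'+, C1_01 (Z h) (Z' h).
  apply: filterS err_C1_01 => h Ce.
  by apply: C1_01B; [exact: C1_01Z|exact: C1_01_poly].
have ZO : unifO (2 * s) (fun h t => Z' h t - \sum_j (a j h).[t] * err j h t).
  pose lin h t := F (stage h t) i 0 - F (y (t * h)) i 0 - \sum_j A i j h t * err j h t.
  have linO : unifO (2 * s) lin.
    by apply: unifO_le (Alin i _ (err_unifO (leqnn _))); rewrite mul2n -addnn leq_add.
  have O3 : unifO (2 * s) (fun h t => \sum_j (A i j h t - (a j h).[t]) * err j h t).
    apply: unifO_sum => j.
    have -> : (2 * s = s.-1 + s.+1)%N by rewrite mul2n -addnn addnS -addSn prednK.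
    by apply: unifOM; [have [] := aO j|exact: err_unifO].
  apply: eq_unifO (unifOB (unifOD linO O3) rO).
  apply: filterS (near_le1 R) => h /andP[h0 _] t _.
  have -> : \sum_j (A i j h t - (a j h).[t]) * err j h t =
      \sum_j A i j h t * err j h t - \sum_j (a j h).[t] * err j h t.
    by rewrite -sumrB; apply: eq_bigr => j _; rewrite mulrBl.
  rewrite /Z' /lin /err' defectE hornerC.
  by field; rewrite gt_eqF.
have a0 j : graded 0 (a j) by have [] := aO j.
have a1 j h : (size (a j h) <= s.-1)%N by have [_ ->] := aO j.
have := unifOM (@unifO_pow R 1) (unifOD (weighted_estimate0 a0 a1 CZ ZO) rO1).
rewrite addnC; apply: eq_unifO; apply: filterS2 (near_hbvm HU) (err0 i) => h [h0 _] e0 _ _.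
rewrite /Z e0 /err stage_at1 mul1r.
by field; rewrite gt_eqF.
Qed.

End Error.

(** * Smooth vector fields *)

Section TameClosure.
Variables (R : realType) (n N : nat) (y0 : 'cV[R]_n).
Implicit Types phi psi : 'cV[R]_n -> R.
Local Notation tame := (tame N y0).
Local Notation linearisable := (linearisable N y0).

Lemma tame_cst (a : R) : tame (fun=> a).
Proof. by split=> [M|z m _ _ _]; [exists `|a| |exact: scaled_cst]. Qed.

Lemma tame_coord j : tame (fun x => x j 0).
Proof. by split=> [M|z m _ zj _]; [exists M => x; apply|exact: zj]. Qed.

Lemma tameD phi psi : tame phi -> tame psi -> tame (fun x => phi x + psi x).
Proof.
move=> [phiM phiS] [psiM psiS]; split=> [M|z m mN zS z0].
  have [C HC] := phiM M; have [D HD] := psiM M; exists (C + D) => x xM.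
  by rewrite (le_trans (ler_normD _ _))// lerD ?HC ?HD.
by apply: scaledD; [exact: phiS|exact: psiS].
Qed.

Lemma tameM phi psi : tame phi -> tame psi -> tame (fun x => phi x * psi x).
Proof.
move=> [phiM phiS] [psiM psiS]; split=> [M|z m mN zS z0].
  have [C HC] := phiM M; have [D HD] := psiM M; exists (C * D) => x xM.
  by rewrite normrM ler_pM ?HC ?HD.
by apply: scaledM; [exact: phiS|exact: psiS].
Qed.

Lemma tame_comp (g : R -> R) j : cont_diff N g -> tame (fun x => g (x j 0)).
Proof.
move=> gN; split=> [M|z m mN zS z0].
  have [C gC] := continuous_bounded M (cont_diff_continuous gN).
  by exists C => x xM; apply: gC.
by apply: scaled_comp (z0 j) => //; exact: cont_diff_le gN.
Qed.

(** The Euclidean norm is used so that the product of two such bounds is exactly the quadratic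
    remainder needed for products. *)
Lemma linearisable_lipschitz phi : linearisable phi ->
  forall M : R, exists2 K, 0 <= K & forall x z : 'cV[R]_n,
    (forall j, `|x j 0| <= M) -> (forall j, `|z j 0| <= M) ->
    `|phi x - phi z| <= K * Num.sqrt (\sum_j (x j 0 - z j 0) ^+ 2).
Proof.
move=> [_ [A [AT AM]]] M; have [C HC] := AM M.
have [CA HCA] := choice (fun j => (AT j).1 M).
(* [B] bounds the squared distance on the ball, which turns the quadratic remainder into a linear
   one. *)
pose B := \sum_(j < n) (M + M) ^+ 2.
exists (`|C| * Num.sqrt B + \sum_j `|CA j|).
  by rewrite addr_ge0 ?sumr_ge0// mulr_ge0// sqrtr_ge0.
move=> x z xM zM; set S := \sum_j (x j 0 - z j 0) ^+ 2.
have S0 : 0 <= S by apply: sumr_ge0 => j _; exact: sqr_ge0.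
have eM j : `|x j 0 - z j 0| <= M + M by rewrite (le_trans (ler_normB _ _))// lerD.
have SB : S <= B.
  apply: ler_sum => j _; rewrite -(real_normK (num_real _)) lerXn2r ?nnegrE//.
  exact: le_trans (eM j).
have eS j : `|x j 0 - z j 0| <= Num.sqrt S.
  rewrite -sqrtr_sqr ler_wsqrtr// /S (bigD1 j)//= lerDl.
  by apply: sumr_ge0 => l _; exact: sqr_ge0.
rewrite -[phi x - phi z](subrK (\sum_j A j x * (x j 0 - z j 0))) mulrDl.
rewrite (le_trans (ler_normD _ _))// lerD//.
  rewrite (le_trans (HC x z xM zM))// -/S -[X in C * X](sqr_sqrtr S0) expr2 mulrA.
  rewrite ler_wpM2r ?sqrtr_ge0// (le_trans (y := `|C| * Num.sqrt S))//.
    by rewrite ler_wpM2r ?sqrtr_ge0// ler_norm.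
  by rewrite ler_wpM2l// ler_wsqrtr.
rewrite (le_trans (ler_norm_sum _ _ _))// mulr_suml ler_sum// => j _.
rewrite normrM ler_pM//; exact: le_trans (HCA j x xM) (ler_norm _).
Qed.

Lemma linearisable_cst (a : R) : linearisable (fun=> a).
Proof.
split; first exact: tame_cst.
exists (fun _ _ => 0); split=> [j|M]; first exact: tame_cst.
exists 0 => x z _ _; rewrite mul0r big1 => [|j _]; last by rewrite mul0r.
by rewrite subrr subr0 normr0.
Qed.

(** One derivative is spent on the coefficient [derive1 g], which must still be of class C^N, and
    the quadratic remainder asks for class C^2 even if [N] is 0. *)
Lemma linearisable_comp (g : R -> R) j : cont_diff N.+2 g ->
  linearisable (fun x => g (x j 0)).
Proof.
move=> gN; split; first by apply: tame_comp; apply: cont_diff_le gN; rewrite 2?ltnW.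
exists (fun l x => if l == j then derive1 g (x j 0) else 0); split=> [l|M].
  case: eqP => _; last exact: tame_cst.
  apply: tame_comp; have [_] := cont_diffS gN.
  exact: cont_diff_le.
have [C gC] := linearisation M (cont_diff_le (leq0n N : 2 <= N.+2)%N gN).
exists `|C| => x z xM zM.
rewrite (bigD1 j)//= eqxx big1 ?addr0 => [|l /negPf ->]; last by rewrite mul0r.
rewrite (le_trans (gC _ _ (xM j) (zM j)))// (bigD1 j)//= mulrDr.
rewrite (le_trans (y := `|C| * (x j 0 - z j 0) ^+ 2))//.
  by rewrite ler_wpM2r ?sqr_ge0// ler_norm.
by rewrite lerDl mulr_ge0// sumr_ge0// => l _; exact: sqr_ge0.
Qed.

Lemma linearisable_coord j : linearisable (fun x => x j 0).
Proof.
split; first exact: tame_coord.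
exists (fun l _ => (l == j)%:R); split=> [l|M]; first exact: tame_cst.
exists 0 => x z _ _; rewrite mul0r (bigD1 j)//= eqxx mul1r big1 => [|l /negPf ->].
  by rewrite addr0 subrr normr0.
by rewrite mul0r.
Qed.

Lemma linearisableD phi psi : linearisable phi -> linearisable psi ->
  linearisable (fun x => phi x + psi x).
Proof.
move=> [phiT [A [AT AM]]] [psiT [B [BT BM]]]; split; first exact: tameD.
exists (fun j x => A j x + B j x); split=> [j|M]; first exact: tameD.
have [C HC] := AM M; have [D HD] := BM M; exists (C + D) => x z xM zM.
rewrite mulrDl (le_trans _ (lerD (HC x z xM zM) (HD x z xM zM)))//.
rewrite (le_trans _ (ler_normD _ _))//.
under eq_bigr do rewrite mulrDl.
by rewrite big_split /= le_eqVlt; apply/orP; left; apply/eqP; congr `|_|; ring.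
Qed.

(** The Leibniz rule for increments leaves the product of the two increments, which the Lipschitz
    bounds make quadratic. *)
Lemma linearisableM phi psi : linearisable phi -> linearisable psi ->
  linearisable (fun x => phi x * psi x).
Proof.
move=> /[dup] phiL [phiT [A [AT AM]]] /[dup] psiL [psiT [B [BT BM]]]; split; first exact: tameM.
exists (fun j x => phi x * B j x + psi x * A j x); split=> [j|M].
  by apply: tameD; exact: tameM.
have [C1 HC1] := AM M; have [C2 HC2] := BM M.
have [K1 K10 HK1] := linearisable_lipschitz phiL M.
have [K2 K20 HK2] := linearisable_lipschitz psiL M.
have [D1 HD1] := phiT.1 M; have [D2 HD2] := psiT.1 M.
exists (D1 * C2 + D2 * C1 + K1 * K2) => x z xM zM.
set S := \sum_j (x j 0 - z j 0) ^+ 2.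
have S0 : 0 <= S by apply: sumr_ge0 => j _; exact: sqr_ge0.
have -> : phi x * psi x - phi z * psi z -
    \sum_j (phi x * B j x + psi x * A j x) * (x j 0 - z j 0) =
    phi x * (psi x - psi z - \sum_j B j x * (x j 0 - z j 0)) +
    psi x * (phi x - phi z - \sum_j A j x * (x j 0 - z j 0)) -
    (phi x - phi z) * (psi x - psi z).
  have -> : \sum_j (phi x * B j x + psi x * A j x) * (x j 0 - z j 0) =
      phi x * (\sum_j B j x * (x j 0 - z j 0)) +
      psi x * (\sum_j A j x * (x j 0 - z j 0)).
    rewrite !mulr_sumr -big_split; apply: eq_bigr => j _ /=.
    by rewrite mulrDl !mulrA.
  ring.
rewrite (le_trans (ler_normB _ _))// [X in _ <= X]mulrDl lerD//.
  rewrite (le_trans (ler_normD _ _))// [X in _ <= X]mulrDl !normrM -!mulrA.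
  by rewrite lerD// ler_pM ?HD1 ?HD2 ?HC1 ?HC2.
rewrite normrM -[S](sqr_sqrtr S0) expr2 mulrACA.
by rewrite ler_pM ?HK1 ?HK2.
Qed.

Lemma linearisable_sum (I : Type) (r : seq I) (phi : I -> 'cV[R]_n -> R) :
  (forall i, linearisable (phi i)) -> linearisable (fun x => \sum_(i <- r) phi i x).
Proof.
move=> phiL; elim: r => [|i r IHr].
  by under [X in linearisable X]eq_fun do rewrite big_nil; exact: linearisable_cst.
under [X in linearisable X]eq_fun do rewrite big_cons.
exact: linearisableD.
Qed.

Lemma linearisableZ (a : R) phi : linearisable phi -> linearisable (fun x => a * phi x).
Proof. by move=> phiL; apply: linearisableM => //; exact: linearisable_cst. Qed.

End TameClosure.

(** * The augmented wave equation *)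

Section Gradient.
Variables (R : realType) (N : nat) (f phi0 phi1 : R -> R).
Local Notation D := (dx R N).
Local Notation df := (derive1 f).
Local Notation ph t := (bdry N phi0 phi1 t).
Local Notation ph' t := (bdry N (derive1 phi0) (derive1 phi1) t).
Local Notation T := (T_mx R N).

Lemma dx_neq0 : D != 0.
Proof. by rewrite invr_eq0 pnatr_eq0. Qed.

Definition iq (j : 'I_N) : 'I_(N + N + (1 + 1)) := lshift (1 + 1) (lshift N j).
Definition ip (j : 'I_N) : 'I_(N + N + (1 + 1)) := lshift (1 + 1) (rshift N j).
Definition iqt : 'I_(N + N + (1 + 1)) := rshift (N + N) (lshift 1 ord0).
Definition ipt : 'I_(N + N + (1 + 1)) := rshift (N + N) (rshift 1 ord0).

Lemma st_qE (x : state R N) j : st_q x j 0 = x (iq j) 0.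
Proof. by rewrite !mxE. Qed.
Lemma st_pE (x : state R N) j : st_p x j 0 = x (ip j) 0.
Proof. by rewrite !mxE. Qed.
Lemma st_qtE (x : state R N) : st_qt x = x iqt 0.
Proof. by rewrite /st_qt !mxE. Qed.
Lemma st_ptE (x : state R N) : st_pt x = x ipt 0.
Proof. by rewrite /st_pt !mxE. Qed.

Lemma state_sum (G : 'I_(N + N + (1 + 1)) -> R) :
  \sum_i G i = \sum_j G (iq j) + \sum_j G (ip j) + (G iqt + G ipt).
Proof.
rewrite big_split_ord; congr (_ + _); first exact: big_split_ord.
by rewrite big_split_ord !big_ord1.
Qed.

Lemma state_ind (Pr : 'I_(N + N + (1 + 1)) -> Prop) :
  (forall j, Pr (iq j)) -> (forall j, Pr (ip j)) -> Pr iqt -> Pr ipt -> forall i, Pr i.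
Proof.
move=> Hq Hp Ht He i; case: (split_ordP i) => {}i ->; case: (split_ordP i) => {}i ->;
  [exact: Hq|exact: Hp|rewrite (ord1 i); exact: Ht|rewrite (ord1 i); exact: He].
Qed.

Lemma aHamE (x : state R N) : aHam f phi0 phi1 x =
  D * ((\sum_j x (ip j) 0 * x (ip j) 0) / 2 +
       (\sum_j (\sum_l T j l * x (iq l) 0) * x (iq j) 0) / (2 * D ^+ 2) +
       \sum_j f (x (iq j) 0)) +
  (\sum_j ph (x iqt 0) j 0 * ph (x iqt 0) j 0) / (2 * D) -
  (\sum_j x (iq j) 0 * ph (x iqt 0) j 0) / D + x ipt 0.
Proof.
rewrite /aHam /Ham st_ptE st_qtE; congr (_ * (_ / _ + _ / _ + _) + _ / _ - _ / _ + _).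
- by rewrite mxE; apply: eq_bigr => j _; rewrite mxE !st_pE.
- rewrite -mulmxA mxE; apply: eq_bigr => j _; rewrite mxE st_qE mulrC; congr (_ * _).
  by rewrite mxE; apply: eq_bigr => l _; rewrite st_qE.
- by apply: eq_bigr => j _; rewrite st_qE.
- by rewrite mxE; apply: eq_bigr => j _; rewrite mxE.
- by rewrite mxE; apply: eq_bigr => j _; rewrite mxE st_qE.
Qed.

Lemma T_sym j l : T j l = T l j.
Proof. by rewrite !mxE eq_sym orbC. Qed.

Definition grad_q (x : state R N) (j : 'I_N) : R :=
  D^-1 * (\sum_l T j l * x (iq l) 0) + D * df (x (iq j) 0) - D^-1 * ph (x iqt 0) j 0.
Definition grad_p (x : state R N) (j : 'I_N) : R := D * x (ip j) 0.
Definition grad_t (x : state R N) : R :=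
  D^-1 * (\sum_j ph (x iqt 0) j 0 * ph' (x iqt 0) j 0) -
  D^-1 * (\sum_j x (iq j) 0 * ph' (x iqt 0) j 0).

Definition egrad (x : state R N) : state R N :=
  col_mx (col_mx (\col_j grad_q x j) (\col_j grad_p x j)) (col_mx (grad_t x)%:M 1%:M).

Lemma egrad_q x j : egrad x (iq j) 0 = grad_q x j.
Proof. by rewrite /egrad /iq !col_mxEu mxE. Qed.
Lemma egrad_p x j : egrad x (ip j) 0 = grad_p x j.
Proof. by rewrite /egrad /ip col_mxEu col_mxEd mxE. Qed.
Lemma egrad_qt x : egrad x iqt 0 = grad_t x.
Proof. by rewrite /egrad /iqt col_mxEd col_mxEu mxE. Qed.
Lemma egrad_pt x : egrad x ipt 0 = 1.
Proof. by rewrite /egrad /ipt !col_mxEd mxE. Qed.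

Hypotheses (Df : forall x, derivable f x 1).
Hypotheses (D0 : forall x, derivable phi0 x 1) (D1 : forall x, derivable phi1 x 1).

Lemma is_derive_bdry j (t : R) : is_derive t 1 (fun t => ph t j 0) (ph' t j 0).
Proof.
have -> : (fun t => ph t j 0) = (fun t => (if j == 0 :> nat then 1 else 0) * phi0 t +
    (if j.+1 == N then 1 else 0) * phi1 t).
  by apply/funext => u; rewrite mxE; do 2 case: ifP => _; rewrite ?mul1r ?mul0r.
have -> : ph' t j 0 = (if j == 0 :> nat then 1 else 0) * derive1 phi0 t +
    (if j.+1 == N then 1 else 0) * derive1 phi1 t.
  by rewrite mxE; do 2 case: ifP => _; rewrite ?mul1r ?mul0r.
by apply: is_deriveD_fun; apply: is_deriveZ_fun; exact: is_derive_derive1.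
Qed.

(** Stated along an arbitrary differentiable curve: straight lines yield the gradient, and the
    numerical solution yields the energy balance. *)
Lemma is_derive_aHam (z : R -> state R N) (dz : state R N) (t : R) :
  (forall i, is_derive t 1 (fun t => z t i 0) (dz i 0)) ->
  is_derive t 1 (fun t => aHam f phi0 phi1 (z t)) (\sum_i egrad (z t) i 0 * dz i 0).
Proof.
move=> Dz.
have Df' j := is_derive_comp_fun (@is_derive_derive1 R f (z t (iq j) 0) (@Df _)) (Dz (iq j)).
have Dph j := is_derive_comp_fun (is_derive_bdry j (z t iqt 0)) (Dz iqt).
have H1 := is_derive_sum_fun (index_enum 'I_N) (fun j => is_deriveM_fun (Dz (ip j)) (Dz (ip j))).
have H2 := is_derive_sum_fun (index_enum 'I_N) (fun j => is_deriveM_fun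
  (is_derive_sum_fun (index_enum 'I_N) (fun l => is_deriveZ_fun (T j l) (Dz (iq l)))) (Dz (iq j))).
have H3 := is_derive_sum_fun (index_enum 'I_N) Df'.
have H4 := is_derive_sum_fun (index_enum 'I_N) (fun j => is_deriveM_fun (Dph j) (Dph j)).
have H5 := is_derive_sum_fun (index_enum 'I_N) (fun j => is_deriveM_fun (Dz (iq j)) (Dph j)).
have := is_deriveD_fun (is_deriveD_fun (is_deriveD_fun (is_deriveZ_fun D
  (is_deriveD_fun (is_deriveD_fun (is_deriveZ_fun 2^-1 H1)
    (is_deriveZ_fun (2 * D ^+ 2)^-1 H2)) H3)) (is_deriveZ_fun (2 * D)^-1 H4))
  (is_deriveZ_fun (- D^-1) H5)) (Dz ipt).
set dH := (X in is_derive _ _ _ X -> _).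
have -> : dH = \sum_i egrad (z t) i 0 * dz i 0.
  rewrite state_sum egrad_qt egrad_pt mul1r /dH addrA; congr (_ + _).
  under [X in _ = X + _ + _]eq_bigr do rewrite egrad_q.
  under [X in _ = _ + X + _]eq_bigr do rewrite egrad_p.
  set q := fun j => z t (iq j) 0; set dq := fun j => dz (iq j) 0.
  set p := fun j => z t (ip j) 0; set dp := fun j => dz (ip j) 0.
  set u := z t iqt 0; set du := dz iqt 0.
  have E1 : \sum_j (dp j * p j + p j * dp j) = 2 * \sum_j p j * dp j.
    by rewrite mulr_sumr; apply: eq_bigr => j _; ring.
  (* Symmetry of [T] identifies the two halves of the derivative of the quadratic form. *)
  have E2 : \sum_j ((\sum_l T j l * dq l) * q j + (\sum_l T j l * q l) * dq j) =
      2 * \sum_j (\sum_l T j l * q l) * dq j.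
    rewrite big_split mulr2n mulrDl mul1r /=; congr (_ + _).
    under eq_bigr do rewrite mulr_suml; rewrite exchange_big /=.
    apply: eq_bigr => j _; rewrite mulr_suml; apply: eq_bigr => l _.
    by rewrite T_sym mulrAC.
  have E4 : \sum_j (ph' u j 0 * du * ph u j 0 + ph u j 0 * (ph' u j 0 * du)) =
      2 * (\sum_j ph u j 0 * ph' u j 0) * du.
    by rewrite mulr_sumr mulr_suml; apply: eq_bigr => j _; ring.
  have E5 : \sum_j (dq j * ph u j 0 + q j * (ph' u j 0 * du)) =
      \sum_j dq j * ph u j 0 + (\sum_j q j * ph' u j 0) * du.
    by rewrite big_split mulr_suml; congr (_ + _); apply: eq_bigr => j _; rewrite mulrA.
  have E6 : \sum_j grad_q (z t) j * dq j = D^-1 * (\sum_j (\sum_l T j l * q l) * dq j) +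
      D * (\sum_j df (q j) * dq j) - D^-1 * (\sum_j dq j * ph u j 0).
    rewrite !mulr_sumr -big_split -sumrB; apply: eq_bigr => j _ /=.
    by rewrite /grad_q; ring.
  have E7 : \sum_j grad_p (z t) j * dp j = D * (\sum_j p j * dp j).
    by rewrite mulr_sumr; apply: eq_bigr => j _; rewrite mulrA.
  rewrite E1 E2 E4 E5 E6 E7 /grad_t -/u -/du.
  by field; rewrite dx_neq0.
move=> H; apply: (eq_ind _ (fun g => is_derive t 1 g _) H).
by apply/funext => u; rewrite aHamE; ring.
Qed.

(** Each partial derivative is the derivative at 0 along the line through [x] in a coordinate
    direction. *)
Lemma gradE (x : state R N) : grad (aHam f phi0 phi1) x = egrad x.
Proof.
apply/matrixP => i j; rewrite ord1 mxE.
pose z (t : R) : state R N := t *: delta_mx i 0 + x.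
have Dz l : is_derive (0 : R) 1 (fun t => z t l 0) ((delta_mx i 0 : state R N) l 0).
  have -> : (fun t => z t l 0) = (fun t => (delta_mx i 0 : state R N) l 0 * t + x l 0).
    by apply/funext => t; rewrite mxE [X in X + _]mxE mulrC.
  have := is_deriveD_fun (is_deriveZ_fun ((delta_mx i 0 : state R N) l 0)
    (is_derive_id (0 : R) (1 : R))) (is_derive_cst_fun 0 (x l 0)).
  by rewrite mulr1 addr0.
have := is_derive_aHam Dz => H.
have -> : 'D_(delta_mx i 0) (aHam f phi0 phi1) x = 'D_1 (fun t => aHam f phi0 phi1 (z t)) (0 : R).
  rewrite /derive; apply: (congr1 (fun g : R -> R => lim (g h @[h --> 0^']))).
  apply/funext => h /=.
  by rewrite /z addr0 scale0r add0r [h *: 1]mulr1.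
have dE l : (delta_mx i 0 : state R N) l 0 = (l == i)%:R by rewrite mxE andbT.
rewrite (@derive_val _ _ _ _ _ _ _ H) (bigD1 i)//= dE eqxx mulr1 big1 ?addr0.
  by rewrite /z scale0r add0r.
by move=> l /negPf li; rewrite dE li mulr0.
Qed.

End Gradient.

(** * The skew structure and the regularity of the vector field *)

Section VectorField.
Variables (R : realType) (N : nat).

Lemma symp_mul n (a b : 'cV[R]_n) : symp R n *m col_mx a b = col_mx b (- a).
Proof. by rewrite mul_block_col !mul0mx mul1mx mulNmx mul1mx add0r addr0. Qed.

Lemma symp_sqr n : symp R n *m symp R n = - 1%:M.
Proof.
rewrite mulmx_block !mul0mx !mulmx0 !add0r !addr0 mul1mx mulmx1.
by rewrite [in RHS]scalar_mx_block opp_block_mx !oppr0.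
Qed.

Lemma tr_symp n : (symp R n)^T = - symp R n.
Proof.
by rewrite tr_block_mx !trmx0 linearN /= !trmx1 opp_block_mx !oppr0 opprK.
Qed.

(** The inverse of [aJ], written out using symp^2 = -1. It is the skew matrix S for which the
    gradient of the energy is S F. *)
Definition aJinv : 'M[R]_(N + N + (1 + 1)) :=
  block_mx (- (dx R N *: symp R N)) 0 0 (- symp R 1).

Lemma tr_aJinv : aJinv^T = - aJinv.
Proof.
have trN n (A : 'M[R]_n) : (- A)^T = - A^T by rewrite linearN.
have trZ n a (A : 'M[R]_n) : (a *: A)^T = a *: A^T by rewrite linearZ.
by rewrite tr_block_mx !trmx0 !trN trZ !tr_symp [RHS]opp_block_mx !oppr0 scalerN.
Qed.

Lemma aJinvK : aJinv *m aJ R N = 1%:M.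
Proof.
rewrite mulmx_block !mul0mx !mulmx0 !add0r !addr0 -!scalemxAr !mulNmx -scalemxAl.
rewrite !symp_sqr scalerN !opprK scalerA mulVf ?dx_neq0// scale1r.
by rewrite opprK -scalar_mx_block.
Qed.

Variables (f phi0 phi1 : R -> R).
Hypotheses (Df : forall x, derivable f x 1).
Hypotheses (D0 : forall x, derivable phi0 x 1) (D1 : forall x, derivable phi1 x 1).
Local Notation F := (@vfield R N f phi0 phi1).

Lemma vfieldE (x : state R N) : F x = col_mx
  (col_mx (\col_j ((dx R N)^-1 * grad_p x j)) (- \col_j ((dx R N)^-1 * grad_q f phi0 phi1 x j)))
  (col_mx 1%:M (- (grad_t phi0 phi1 x)%:M)).
Proof.
rewrite /vfield gradE// /aJ /egrad mul_block_col !mul0mx addr0 add0r symp_mul.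
rewrite -scalemxAl symp_mul scale_col_mx scalerN.
congr (col_mx (col_mx _ (- _)) _); apply/matrixP => i j; by rewrite !mxE.
Qed.

Lemma egrad_vfield (x : state R N) : egrad f phi0 phi1 x = aJinv *m F x.
Proof. by rewrite /vfield mulmxA aJinvK mul1mx gradE. Qed.

Lemma vfield_qt (x : state R N) : F x (iqt N) 0 = 1.
Proof. by rewrite vfieldE /iqt col_mxEd col_mxEu mxE. Qed.

(** The field contains first derivatives of [f], [phi0] and [phi1], and [linearisable_comp] takes
    two more than [m]: hence [m.+3]. *)
Lemma vfield_linearisable m (y0 : state R N) :
  cont_diff m.+3 f -> cont_diff m.+3 phi0 -> cont_diff m.+3 phi1 ->
  forall i, linearisable m y0 (fun y => F y i 0).
Proof.
move=> fm p0m p1m.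
have low (g : R -> R) : cont_diff m.+3 g -> cont_diff m.+2 g := @cont_diff_le _ _ _ _ (leqnSn _).
have der (g : R -> R) : cont_diff m.+3 g -> cont_diff m.+2 (derive1 g) by move=> /cont_diffS[].
have bd (g0 g1 : R -> R) j : cont_diff m.+2 g0 -> cont_diff m.+2 g1 ->
    linearisable m y0 (fun y => bdry N g0 g1 (y (iqt N) 0) j 0).
  move=> g0m g1m.
  have -> : (fun y : state R N => bdry N g0 g1 (y (iqt N) 0) j 0) =
    (fun y => (if j == 0 :> nat then 1 else 0) * g0 (y (iqt N) 0) +
              (if j.+1 == N then 1 else 0) * g1 (y (iqt N) 0)).
    by apply/funext => y; rewrite mxE; do 2 case: ifP => _; rewrite ?mul1r ?mul0r.
  by apply: linearisableD; apply: linearisableZ; exact: linearisable_comp.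
have lZ (a : R) (phi : state R N -> R) : linearisable m y0 phi ->
    linearisable m y0 (fun x => a * phi x).
  exact: linearisableZ.
have lB (phi psi : state R N -> R) : linearisable m y0 phi -> linearisable m y0 psi ->
    linearisable m y0 (fun x => phi x - psi x).
  move=> pl ql; have := linearisableD pl (lZ (-1) _ ql).
  by under eq_fun do rewrite mulN1r.
apply: state_ind => [j|j||].
- have -> : (fun y => F y (iq j) 0) = (fun y => (dx R N)^-1 * (dx R N * y (ip j) 0)).
    by apply/funext => y; rewrite vfieldE /iq !col_mxEu mxE.
  by do 2 apply/lZ; exact: linearisable_coord.
- have -> : (fun y => F y (ip j) 0) = (fun y => -1 * ((dx R N)^-1 * grad_q f phi0 phi1 y j)).
    by apply/funext => y; rewrite vfieldE /ip col_mxEu col_mxEd !mxE mulN1r.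
  do 2 apply/lZ; apply/lB; last by apply/lZ; apply: bd; exact: low.
  apply: linearisableD.
    apply/lZ; apply: linearisable_sum => l; apply/lZ; exact: linearisable_coord.
  by apply/lZ; apply: linearisable_comp; exact: der.
- have -> : (fun y => F y (iqt N) 0) = (fun=> 1) by apply/funext => y; rewrite vfield_qt.
  exact: linearisable_cst.
- have -> : (fun y => F y (ipt N) 0) = (fun y => -1 * grad_t phi0 phi1 y).
    by apply/funext => y; rewrite vfieldE /ipt !col_mxEd !mxE mulN1r.
  apply/lZ; apply/lB; apply/lZ; apply: linearisable_sum => l; apply: linearisableM.
  + by apply: bd; exact: low.
  + by apply: bd; exact: der.
  + exact: linearisable_coord.
  + by apply: bd; exact: der.
Qed.

Lemma is_derive_energy (z : R -> state R N) (dz : state R N) (t : R) :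
  (forall i, is_derive t 1 (fun t => z t i 0) (dz i 0)) ->
  is_derive t 1 (fun t => aHam f phi0 phi1 (z t)) (\sum_i (aJinv *m F (z t)) i 0 * dz i 0).
Proof. by rewrite -egrad_vfield; exact: is_derive_aHam. Qed.

End VectorField.

(** * Exact conservation for polynomial data *)

Section PolynomialEnergy.
Variables (R : realType) (P : nat -> {poly R}) (k s : nat) (c b : 'I_k -> R).
Hypotheses (HP : legendre_family P) (Hg : gauss_legendre P c b).
Hypotheses (s1 : (1 <= s)%N) (sk : (s <= k)%N).
Variables (N : nat) (f phi0 phi1 : R -> R).
Hypotheses (Df : forall x, derivable f x 1).
Hypotheses (D0 : forall x, derivable phi0 x 1) (D1 : forall x, derivable phi1 x 1).
Local Notation F := (@vfield R N f phi0 phi1).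
Local Notation D := (dx R N).

Lemma poly_eq01 (p q : {poly R}) : (forall x, 0 <= x <= 1 -> p.[x] = q.[x]) -> p = q.
Proof.
move=> pq; apply/eqP; rewrite -subr_eq0; apply: contraT => /(Int_sqr_gt0 HP).
rewrite -oppr_lt0 -linearN /= ltNge Int_ge0// => x /pq E.
by rewrite hornerN hornerM hornerD hornerN E subrr mulr0 oppr0.
Qed.

(** The time component of the field is the constant 1, which the discrete projection reproduces.
    Hence the numerical time is exactly c h, and the boundary data have degree rho in c rather than
    rho s. *)
Lemma slope_qt h u : slope P s c b F h u (iqt N) = 1.
Proof.
have s1' : (size (1%R : {poly R}) <= s)%N by rewrite size_poly1.
rewrite [RHS](legendre_expansion HP s1'); apply: eq_bigr => j _.
rewrite hbvm_gammaE mulr1 -(gauss_exact HP Hg); last first.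
  by rewrite size_legendre// (leq_trans (leq_trans (ltn_ord j) sk))// leq_addr.
by congr (_ *: _); apply: eq_bigr => l _; rewrite vfield_qt// mulr1.
Qed.

(** The energy along the numerical solution is a polynomial [K] in c of degree at most 2k. The
    quadrature is therefore exact on its derivative, where it gives 0 by [energy_quadrature]. *)
Lemma energy_exact (nu rho : nat) (psi0 psi1 : R -> R) (h : R)
    (u : 'cV[{poly R}]_(N + N + (1 + 1))) :
  is_poly_le nu f -> is_poly_le rho phi0 -> is_poly_le rho phi1 ->
  (maxn (nu * s) (maxn (2 * rho + s - 1) (rho + 2 * s - 1)) <= 2 * k)%N ->
  hbvm P s c b F (init N psi0 psi1) h u ->
  aHam f phi0 phi1 (peval u h) - aHam f phi0 phi1 (init N psi0 psi1) = 0.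
Proof.
move=> [pf spf fE] [p0 sp0 p0E] [p1 sp1 p1E]; rewrite !geq_max => /and3P[K1 K2 K3] Hu.
have [su u0 _] := Hu.
pose v i : {poly R} := u i 0 \Po (h *: 'X).
have vE x i : peval u (x * h) i 0 = (v i).[x].
  by rewrite mxE /v horner_comp hornerZ hornerX mulrC.
have sX : (size (h *: 'X)%R <= 2)%N.
  by rewrite (leq_trans (size_scale_leq _ _))// size_polyX.
have scomp (p q : {poly R}) a e : (size p <= a.+1)%N -> (size q <= e.+1)%N ->
    (size (p \Po q) <= (a * e).+1)%N.
  move=> pa qe; rewrite (leq_trans (size_comp_poly_leq _ _))// ltnS leq_mul//; lia.
have sv i : (size (v i) <= s.+1)%N by rewrite -[s]muln1; apply: scomp.
have vqt : v (iqt N) = h *: 'X.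
  apply: poly_eq01 => x x01; rewrite -vE (peval_slope Hu)// slope_qt.
  have -> : init N psi0 psi1 (iqt N) 0 = 0.
    by rewrite /init /iqt col_mxEd mxE.
  rewrite add0r hornerZ hornerX; congr (_ * _).
  have -> : prim (1 : {poly R}) = 'X.
    have := prim_deriv ('X : {poly R}); rewrite derivX hornerX => ->.
    by rewrite polyC0 subr0.
  by rewrite hornerX.
pose B (j : 'I_N) : {poly R} := (if j == 0 :> nat then p0 \Po (h *: 'X) else 0) +
  (if j.+1 == N then p1 \Po (h *: 'X) else 0).
have BE j x : (B j).[x] = bdry N phi0 phi1 (h * x) j 0.
  rewrite mxE /B hornerD p0E p1E.
  by do 2 case: ifP => _; rewrite ?horner0 ?horner_comp ?hornerZ ?hornerX.
have sB j : (size (B j) <= rho.+1)%N.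
  have Hp (p : {poly R}) : (size p <= rho.+1)%N -> (size (p \Po (h *: 'X))%R <= rho.+1)%N.
    by move=> pr; rewrite -[rho]muln1; apply: scomp.
  rewrite (leq_trans (size_polyD _ _))// geq_max.
  by do 2 case: ifP => _; rewrite ?size_poly0 ?Hp.
have sM (p q : {poly R}) a e : (size p <= a.+1)%N -> (size q <= e.+1)%N ->
    (a + e <= 2 * k)%N -> (size (p * q)%R <= (2 * k).+1)%N.
  move=> pa qe ae; rewrite (leq_trans (size_polyMleq _ _))//; lia.
pose K : {poly R} := D *: (2^-1 *: (\sum_j v (ip j) * v (ip j)) +
   (2 * D ^+ 2)^-1 *: (\sum_j (\sum_l T_mx R N j l *: v (iq l)) * v (iq j)) +
   \sum_j (pf \Po v (iq j))) + (2 * D)^-1 *: (\sum_j B j * B j) -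
   D^-1 *: (\sum_j v (iq j) * B j) + v (ipt N).
have KE x : K.[x] = aHam f phi0 phi1 (peval u (x * h)).
  rewrite aHamE vE vqt hornerZ hornerX /K.
  rewrite !hornerD hornerN !hornerZ !hornerD !hornerZ !horner_sum vE ![_^-1 * _]mulrC.
  congr ((_ / _ + _ / _ + _) / _ + _ / _ - _ / _ + _); apply: eq_bigr => j _.
  - by rewrite hornerM !vE.
  - rewrite hornerM !vE horner_sum; congr (_ * _); apply: eq_bigr => l _.
    by rewrite hornerZ vE.
  - by rewrite horner_comp fE vE.
  - by rewrite hornerM !BE.
  - by rewrite hornerM BE vE.
have ssum (p : 'I_N -> {poly R}) : (forall j, size (p j) <= (2 * k).+1)%N ->
    (size (\sum_j p j)%R <= (2 * k).+1)%N.
  by move=> pk; rewrite (leq_trans (size_sum _ _ _))//; apply/bigmax_leqP.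
have sZ a (p : {poly R}) : (size p <= (2 * k).+1)%N -> (size (a *: p)%R <= (2 * k).+1)%N.
  by apply: leq_trans; exact: size_scale_leq.
have sD (p q : {poly R}) : (size p <= (2 * k).+1)%N -> (size q <= (2 * k).+1)%N ->
    (size (p + q)%R <= (2 * k).+1)%N.
  by move=> pk qk; rewrite (leq_trans (size_polyD _ _))// geq_max pk.
(* The degrees are s for the conjugate variable, rho + s and 2 rho for the boundary terms, nu s for
   [f], and 2s for the quadratic terms; s >= 1 gives rho + s <= rho + 2s - 1 and 2 rho <= 2 rho + s
   - 1, and s <= k gives 2s <= 2k. *)
have sK : (size K <= (2 * k).+1)%N.
  apply/sD; last by rewrite (leq_trans (sv _))//; lia.
  apply/sD; last first.
    rewrite size_polyN; apply/sZ/ssum => j; apply: (sM _ _ s rho) => //; lia.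
  apply/sD; last by apply/sZ/ssum => j; apply: (sM _ _ rho rho) => //; lia.
  apply/sZ/sD; last first.
    apply/ssum => j; rewrite (leq_trans (scomp _ _ nu s _ _))//; lia.
  apply/sD; apply/sZ/ssum => j; apply: (sM _ _ s s) => //; try lia.
  rewrite (leq_trans (size_sum _ _ _))//; apply/bigmax_leqP => l _.
  by rewrite (leq_trans (size_scale_leq _ _)).
have K'E x : 0 <= x <= 1 -> K^`().[x] =
    h * \sum_i (aJinv R N *m F (peval u (x * h))) i 0 * (slope P s c b F h u i).[x].
  move=> x01.
  pose dz : state R N := \col_i (h * (slope P s c b F h u i).[x]).
  have Dz i : is_derive x 1 (fun t => peval u (t * h) i 0) (dz i 0).
    by rewrite mxE; exact: (is_derive_peval Hu).
  have H1 := is_derive_energy Df D0 D1 Dz.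
  have H2 := is_derive_poly K x.
  have E : horner K = (fun t => aHam f phi0 phi1 (peval u (t * h))).
    by apply/funext.
  rewrite -(@derive_val _ _ _ _ _ _ _ H2) E (@derive_val _ _ _ _ _ _ _ H1) mulr_sumr.
  by apply: eq_bigr => i _; rewrite [X in _ * X]mxE mulrCA.
have IK : Int K^`() = 0.
  rewrite -(gauss_exact HP Hg); last first.
    rewrite addnn -mul2n; apply: (leq_trans (size_poly _ _)); lia.
  rewrite (eq_quadrature HP Hg K'E) quadratureZ.
  by rewrite (energy_quadrature HP Hg sk F h u (tr_aJinv R N)) mulr0.
by move: IK; rewrite Int_deriv !KE mul1r mul0r u0.
Qed.

End PolynomialEnergy.

Theorem theorem3 (R : realType) (k s : nat) (s_ge1 : (1 <= s)%N)
    (s_le_k : (s <= k)%N) :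
  (* "suitably regular": of class C^m, for a large enough m *)
  exists m : nat,
  forall (P : nat -> {poly R}) (c b : 'I_k -> R)
         (N : nat) (f phi0 phi1 psi0 psi1 : R -> R),
    legendre_family P -> gauss_legendre P c b ->
    (1 <= N)%N ->
    cont_diff m f -> cont_diff m phi0 -> cont_diff m phi1 ->
    let F : state R N -> state R N := vfield f phi0 phi1 in
    let H : state R N -> R := aHam f phi0 phi1 in
    let y0 : state R N := init N psi0 psi1 in
    (forall (T : R) (y : R -> state R N) (U : R -> 'cV[{poly R}]_(N + N + (1 + 1))),
        0 < T -> is_solution f phi0 phi1 y0 T y ->
        hbvm_method P s c b F y0 U ->
        (fun h : R => peval (U h) h - y h) =O_ (0^'+)
        (fun h : R => h ^+ (2 * s + 1))) /\
    (forall nu rho : nat,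
        let exact := [/\ is_poly_le nu f, is_poly_le rho phi0,
                         is_poly_le rho phi1
                       & (maxn (nu * s)
                            (maxn (2 * rho + s - 1) (rho + 2 * s - 1))
                          <= 2 * k)%N] in
        (exact ->
          forall (h : R) (u : 'cV[{poly R}]_(N + N + (1 + 1))),
            0 < h -> hbvm P s c b F y0 h u ->
            H (peval u h) - H y0 = 0) /\
        (~ exact ->
          forall U : R -> 'cV[{poly R}]_(N + N + (1 + 1)),
            hbvm_method P s c b F y0 U ->
            (fun h : R => H (peval (U h) h) - H y0) =O_ (0^'+)
            (fun h : R => h ^+ (2 * k + 1)))).
Proof.
(* Expansions to order 2k are needed, plus the three derivatives consumed by
   [vfield_linearisable]. *)
exists (2 * k).+3 => P c b N f phi0 phi1 psi0 psi1 HP Hg N1 fm p0m p1m F H y0.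
have [Df _] := cont_diffS fm.
have [D0 _] := cont_diffS p0m.
have [D1 _] := cont_diffS p1m.
have Flin := vfield_linearisable Df D0 D1 y0 fm p0m p1m.
split=> [T y U T0 [y00 yr dy] HU|nu rho exact_]; last split.
- have eO i := error_order HP Hg s_ge1 s_le_k Flin HU T0 y00 yr dy i.
  have [C C0 eC] := unifO_unif eO.
  (* Adding 1 makes the constant positive; the norm of a column is the maximum of its entries. *)
  apply/eqO_exP; exists (C + 1); first by rewrite ltr_wpDl.
  apply: filterS2 (near_le1 R) eC => h /andP[h0 _] eC.
  have hp : 0 <= h ^+ (2 * s + 1) by rewrite exprn_ge0// ltW.
  rewrite (ger0_norm hp) [leLHS]/Num.Def.normr /= mx_normrE.
  rewrite bigmax_le// => [|[i j] _ /=]; first by rewrite mulr_ge0// addr_ge0.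
  rewrite ord1 !mxE.
  have := eC 0 _ i; rewrite !mxE lexx ler01 => /(_ isT)/le_trans; apply.
  by rewrite ler_wpM2r// lerDl.
- move=> [fp p0p p1p kb] h u _ Hu.
  exact: (energy_exact HP Hg s_ge1 s_le_k Df D0 D1 fp p0p p1p kb Hu).
- move=> _ U HU.
  have [C EC] := energy_order HP Hg s_le_k (fun i => (Flin i).1) HU (tr_aJinv R N)
    (fun z dz t => @is_derive_energy _ _ _ _ _ Df D0 D1 z dz t).
  apply/eqO_exP; exists (`|C| + 1); first by rewrite ltr_wpDl.
  apply: filterS2 (near_le1 R) EC => h /andP[h0 _] EC.
  have hp : 0 <= h ^+ (2 * k + 1) by rewrite exprn_ge0// ltW.
  rewrite (ger0_norm hp) (le_trans (EC 0 _)) ?lexx ?ler01//.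
  by rewrite ler_wpM2r// (le_trans (ler_norm _))// lerDl.
Qed.
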